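(* Let $C$ be a minimal abstract clone. If $C$ has a nontrivial weakly abelian representation, then all representations of $C$ are weakly abelian.
   Context: A concrete clone is a composition-closed collection of finitary operations on some set containing all the projections. An abstract clone is a heterogeneous algebra (with one sort for each arity $n\ge 1$) having constants playing the role of projections and operations satisfying the usual identities of composition of concrete clones. A representation of an abstract clone $C$ is a clone homomorphism from $C$ into the concrete clone of all operations on a set $A$; it gives an algebra $\mathbb{A}$ on $A$ whose basic operations are the images of the elements of $C$ (equivalently, of a generating set of $C$). A clone is trivial if it consists of projections only, and minimal if it has exactly two subclones: itself and the clone of projections. An algebra is trivial if its clone of term operations is trivial; a representation is nontrivial or weakly abelian if the corresponding algebra is. For an algebra $\mathbb{A}$, let $\mathcal{M}(\mathbb{A})$ be the set of $2\times 2$ matrices $\begin{pmatrix} t(\mathbf{a},\mathbf{c}) & t(\mathbf{a},\mathbf{d}) \\ t(\mathbf{b},\mathbf{c}) & t(\mathbf{b},\mathbf{d}) \end{pmatrix}$ where $t$ is an $(n+m)$-ary polynomial operation of $\mathbb{A}$ and $\mathbf{a},\mathbf{b}\in A^n$, $\mathbf{c},\mathbf{d}\in A^m$. $\mathbb{A}$ is weakly abelian if $\begin{pmatrix} u & u \\ u & v \end{pmatrix}\in\mathcal{M}(\mathbb{A})$ implies $u=v$. *)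

(* Defs.v *)
From mathcomp Require Import all_boot.

Set Implicit Arguments.
Unset Strict Implicit.
Unset Printing Implicit Defensive.

(** Arities start at 1: the sort [clone_sort C n] consists of the elements of
    [C] of arity [n.+1]. *)
Record clone : Type := Clone {
  clone_sort :> nat -> Type;
  cproj : forall n, 'I_n.+1 -> clone_sort n;
  ccomp : forall n m,
    clone_sort n -> ('I_n.+1 -> clone_sort m) -> clone_sort m;
  ccomp_proj : forall n m (i : 'I_n.+1) (g : 'I_n.+1 -> clone_sort m),
    ccomp (cproj i) g = g i;
  ccomp_id : forall n (f : clone_sort n), ccomp f (@cproj n) = f;
  ccompA : forall n m k (f : clone_sort n) (g : 'I_n.+1 -> clone_sort m)
      (h : 'I_m.+1 -> clone_sort k),
    ccomp (ccomp f g) h = ccomp f (fun i => ccomp (g i) h)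
}.

Arguments cproj {c n} i.
Arguments ccomp {c n m} f g.

Definition is_projection (C : clone) n (f : C n) : Prop :=
  exists i, f = cproj i.

Record is_subclone (C : clone) (S : forall n, C n -> Prop) : Prop := {
  subclone_proj : forall n (i : 'I_n.+1), S n (cproj i);
  subclone_comp : forall n m (f : C n) (g : 'I_n.+1 -> C m),
    S n f -> (forall i, S m (g i)) -> S m (ccomp f g)
}.

Definition trivial_clone (C : clone) : Prop :=
  forall n (f : C n), is_projection f.

(** Exactly two subclones: the clone of projections and [C] itself are
    distinct, and there is no other one. *)
Definition minimal_clone (C : clone) : Prop :=
  ~ trivial_clone C /\
  forall S : (forall n, C n -> Prop), is_subclone S ->
    (forall n (f : C n), S n f <-> is_projection f) \/
    (forall n (f : C n), S n f).

Record clone_hom (C D : clone) : Type := CloneHom {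
  chom :> forall n, C n -> D n;
  chom_proj : forall n (i : 'I_n.+1), chom (cproj i) = cproj i;
  chom_comp : forall n m (f : C n) (g : 'I_n.+1 -> C m),
    chom (ccomp f g) = ccomp (chom f) (fun i => chom (g i))
}.

Definition operation (A : Type) (n : nat) : Type := ('I_n -> A) -> A.

Definition all_operations (A : Type) : clone :=
  @Clone (fun n => operation A n.+1)
    (fun n i x => x i)
    (fun n m f g x => f (fun i => g i x))
    (fun n m i g => erefl) (fun n f => erefl) (fun n m k f g h => erefl).

Definition representation (C : clone) (A : Type) : Type :=
  clone_hom C (all_operations A).

Record algebra : Type := Algebra {
  carrier :> Type;
  symbol : Type;
  arity : symbol -> nat;
  basic_op : forall s : symbol, operation carrier (arity s)
}.

Arguments basic_op {a} s.

Definition rep_algebra (C : clone) (A : Type) (rho : representation C A) :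
    algebra :=
  @Algebra A {n : nat & C n} (fun s => (projT1 s).+1)
    (fun s => rho (projT1 s) (projT2 s)).

Inductive term_op (A : algebra) (n : nat) : operation A n -> Prop :=
| term_proj (i : 'I_n) : term_op (fun x => x i)
| term_basic (s : symbol A) (g : 'I_(arity s) -> operation A n) :
    (forall i, term_op (g i)) ->
    term_op (fun x => basic_op s (fun i => g i x)).

Inductive polynomial_op (A : algebra) (n : nat) : operation A n -> Prop :=
| poly_proj (i : 'I_n) : polynomial_op (fun x => x i)
| poly_const (a : A) : polynomial_op (fun _ => a)
| poly_basic (s : symbol A) (g : 'I_(arity s) -> operation A n) :
    (forall i, polynomial_op (g i)) ->
    polynomial_op (fun x => basic_op s (fun i => g i x)).

Definition trivial_algebra (A : algebra) : Prop :=
  forall n (f : all_operations A n), term_op f -> is_projection f.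

Definition vcat (A : Type) n m (a : 'I_n -> A) (c : 'I_m -> A) :
    'I_(n + m) -> A :=
  fun i => match split i with inl j => a j | inr k => c k end.

(** [matrices A x11 x12 x21 x22] says that the 2 x 2 matrix with rows
    [(x11, x12)] and [(x21, x22)] belongs to M(A). *)
Definition matrices (A : algebra) (x11 x12 x21 x22 : A) : Prop :=
  exists n m (t : operation A (n + m)) (a b : 'I_n -> A) (c d : 'I_m -> A),
    [/\ polynomial_op t,
        x11 = t (vcat a c) /\ x12 = t (vcat a d)
      & x21 = t (vcat b c) /\ x22 = t (vcat b d)].

Definition weakly_abelian (A : algebra) : Prop :=
  forall u v : A, matrices u u u v -> u = v.

(* Main.v *)
From HB Require Import structures.
Require Import Defs.
From mathcomp Require Import all_boot.
From mathcomp Require Import all_order all_algebra.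
From mathcomp Require Import boolp ring.

(** If [C] has a nontrivial unary operation then all its operations are essentially unary. Otherwise let [A] be the
    given representation. An identity [t = x_i] true in [A] holds in [C], since the operations of [C] that are
    projections on [A] form a proper subclone; so it suffices to derive weak abelianness from such absorption
    identities. Weak abelianness of [A] itself produces many of them.
    - If [A] has a Maltsev operation, one absorption identity suffices, and without nontrivial binary operations there
      is always a Maltsev operation.
    - For a nontrivial binary [x y], if [p z = p] and [w q = q] have solutions [z <> p] and [w <> q], then [C] is the
      clone of rectangular bands.
    - If some nontrivial binary operation satisfies [x (x y) = x], then [x (y z) = x y] and [x y^m = x] for some [m],
      and the right multiplications are commuting permutations.
    - Otherwise one may assume that [z u = u] implies [z = u]. Then the free algebra on [x], [y] has an entropic
      quotient and hence an affine one, that is a module over [Z[X]] with [x y] given by [(1 - X) x + X y], and this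
      quotient does not collapse. If no power of a left multiplication [L_x] were the identity, minimality would make
      [X] congruent to a polynomial in [X^k] for each [k], with constraints that are impossible in a finite quotient
      ring. The same holds on the right, and [x / y] and [y \ z] give a Maltsev operation. *)

Set Implicit Arguments.
Unset Strict Implicit.
Unset Printing Implicit Defensive.
Import GRing.Theory Num.Theory Order.TTheory.

(** * Quotients by equivalence relations, as types of classes *)

Section Quotient.
Variables (T : Type) (R : T -> T -> Prop).

Definition quot := {P : T -> Prop | exists x, P = R x}.
Definition quot_pi x : quot := exist _ (R x) (ex_intro _ x erefl).
Definition quot_repr (q : quot) : T := projT1 (cid (proj2_sig q)).

Lemma quot_ext (p q : quot) : proj1_sig p = proj1_sig q -> p = q.
Proof.
by case: p q => [P HP] [Q HQ] /= E; subst Q; congr exist; apply: Prop_irrelevance.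
Qed.

Lemma quot_reprK q : quot_pi (quot_repr q) = q.
Proof. by apply: quot_ext; rewrite /quot_repr /=; case: cid => x /= ->. Qed.

Hypotheses (Rxx : forall x, R x x) (Rsym : forall x y, R x y -> R y x).
Hypothesis Rtrans : forall x y z, R x y -> R y z -> R x z.

Lemma quot_piP x y : quot_pi x = quot_pi y <-> R x y.
Proof.
split=> [E|xy]; first by have := congr1 (@proj1_sig _ _) E => /= ->.
apply: quot_ext; apply/funext => z; apply/propext; split; last exact: Rtrans.
by apply: Rtrans; apply: Rsym.
Qed.

Lemma quot_reprP x : R (quot_repr (quot_pi x)) x.
Proof. by apply/quot_piP; rewrite quot_reprK. Qed.

End Quotient.

(** * Group completion of a commutative monoid *)

Section Grothendieck.
Local Open Scope ring_scope.
Variable N : nmodType.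

(** The slack [e] makes the relation transitive in a monoid without cancellation. *)
Definition groth_rel (x y : N * N) := exists e, x.1 + y.2 + e = y.1 + x.2 + e.

Lemma groth_refl x : groth_rel x x. Proof. by exists 0. Qed.
Lemma groth_sym x y : groth_rel x y -> groth_rel y x.
Proof. by case=> e E; exists e. Qed.
Lemma groth_trans x y z : groth_rel x y -> groth_rel y z -> groth_rel x z.
Proof.
case: x y z => [a b] [c d] [p q] [e /= E1] [f /= E2].
exists (d + e + (c + f)) => /=.
rewrite [LHS]+%R.[AC (2*(2*2)) ((1*3*4)*(5*2*6))] E1 E2.
by rewrite [LHS]+%R.[AC (3*3) ((4*2)*(5*3*(1*6)))].
Qed.

Definition groth := quot groth_rel.
HB.instance Definition _ := gen_eqMixin groth.
HB.instance Definition _ := gen_choiceMixin groth.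

Definition groth_sub a b : groth := quot_pi groth_rel (a, b).

Lemma groth_subP a b c d :
  groth_sub a b = groth_sub c d <-> exists e, a + d + e = c + b + e.
Proof. exact: (quot_piP groth_refl groth_sym groth_trans). Qed.

Lemma groth_ind (P : groth -> Prop) : (forall a b, P (groth_sub a b)) -> forall x, P x.
Proof. by move=> H x; rewrite -(quot_reprK x); case: (quot_repr x). Qed.

Lemma groth_lift (U : Type) (f : N -> N -> U) :
  (forall a b c d e, a + d + e = c + b + e -> f a b = f c d) ->
  {g : groth -> U | forall a b, g (groth_sub a b) = f a b}.
Proof.
move=> H; exists (fun x => f (quot_repr x).1 (quot_repr x).2) => a b.
have [e E] := quot_reprP groth_refl groth_sym groth_trans (a, b).
exact: H E.
Qed.

Definition groth_zero := groth_sub 0 0.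

Definition groth_opp : groth -> groth.
apply: sval (groth_lift (f := fun a b => groth_sub b a) _).
move=> a b c d e E; apply/groth_subP; exists e.
by rewrite [b + c]addrC -E addrC [d + a]addrC addrC.
Defined.

Definition groth_add : groth -> groth -> groth.
apply: sval (groth_lift (f := fun a b =>
  sval (groth_lift (f := fun c d => groth_sub (a + c) (b + d)) _)) _).
- move=> a b c d c' d' e E; apply/groth_subP; exists e.
  by rewrite addrACA -addrA E [RHS]+%R.[AC (2*2*1) ((1*3)*(2*4*5))].
- move=> H a b a' b' e E; apply/funext; elim/groth_ind => c d.
  case: groth_lift => g /= ->; case: groth_lift => g' /= ->.
  apply/groth_subP; exists e.
  rewrite [LHS]+%R.[AC (2*2*1) ((1*3*5)*(2*4))] E.
  by rewrite [LHS]+%R.[AC (3*2) ((1*4)*(2*5)*3)].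
Defined.

Lemma groth_oppE a b : groth_opp (groth_sub a b) = groth_sub b a.
Proof. by rewrite /groth_opp; case: groth_lift => g /= ->. Qed.

Lemma groth_addE a b c d :
  groth_add (groth_sub a b) (groth_sub c d) = groth_sub (a + c) (b + d).
Proof.
rewrite /groth_add; case: groth_lift => g /= ->.
by case: groth_lift => g' /= ->.
Qed.

Fact groth_addA : associative groth_add.
Proof.
elim/groth_ind => a b; elim/groth_ind => c d; elim/groth_ind => e f.
by rewrite !groth_addE !addrA.
Qed.

Fact groth_addC : commutative groth_add.
Proof.
elim/groth_ind => a b; elim/groth_ind => c d.
by rewrite !groth_addE addrC [b + d]addrC.
Qed.

Fact groth_add0 : left_id groth_zero groth_add.
Proof. by elim/groth_ind => a b; rewrite groth_addE !add0r. Qed.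

Fact groth_addN : left_inverse groth_zero groth_opp groth_add.
Proof.
elim/groth_ind => a b; rewrite groth_oppE groth_addE.
by apply/groth_subP; exists 0; rewrite !addr0 !add0r addrC.
Qed.

HB.instance Definition _ := GRing.isZmodule.Build groth
  groth_addA groth_addC groth_add0 groth_addN.

Definition groth_in a : groth := groth_sub a 0.

Lemma groth_inD a b : groth_in (a + b) = groth_in a + groth_in b.
Proof. by rewrite /groth_in [RHS]groth_addE addr0. Qed.

Lemma groth_subE a b : groth_sub a b = groth_in a - groth_in b.
Proof. by rewrite [- _]groth_oppE [RHS]groth_addE addr0 add0r. Qed.

Lemma groth_inP a b : groth_in a = groth_in b <-> exists e, a + e = b + e.
Proof. by rewrite groth_subP !addr0. Qed.

Lemma groth_map (f : N -> N) : f 0 = 0 -> {morph f : a b / a + b} ->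
  {g : {additive groth -> groth} | forall a, g (groth_in a) = groth_in (f a)}.
Proof.
move=> f0 fD.
have H a b c d e : a + d + e = c + b + e ->
    groth_sub (f a) (f b) = groth_sub (f c) (f d).
  by move=> E; apply/groth_subP; exists (f e); rewrite -!fD E.
pose g := sval (groth_lift H).
have gE a b : g (groth_sub a b) = groth_sub (f a) (f b).
  by rewrite /g; case: groth_lift => g' /= ->.
have gB : zmod_morphism g.
  elim/groth_ind => a b; elim/groth_ind => c d.
  by rewrite [- _]groth_oppE [_ + _]groth_addE !gE [- _]groth_oppE [RHS]groth_addE !fD.
pose gm := GRing.isZmodMorphism.Build _ _ g gB.
pose ga : {additive groth -> groth} := HB.pack g gm.
by exists ga => a; rewrite /= gE f0.
Qed.

End Grothendieck.

(** * From an idempotent entropic groupoid to an abelian group *)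

Section Localization.
Variables (M : Type) (mul : M -> M -> M) (o : M).
Local Notation "x * y" := (mul x y).
Hypothesis mulI : forall x, x * x = x.
Hypothesis mulACA : forall a b c d, (a * b) * (c * d) = (a * c) * (b * d).

Local Notation lo x := (o * x).
Local Notation ro x := (x * o).
Definition scale x := o * (x * o).

(* In a module with [x * y = (1 - r) x + r y] and [o = 0] one has [scale x = r (1 - r) x] and
   [scadd a b = r (1 - r) (a + b)]; the sum itself need not exist in [M]. *)
Definition scadd a b := (o * a) * (b * o).

(** Writing [o] as [o * o] turns the entropic law into distributivity. *)
Lemma loM x y : lo (x * y) = lo x * lo y. Proof. by rewrite -{1}(mulI o) mulACA. Qed.
Lemma roM x y : ro (x * y) = ro x * ro y. Proof. by rewrite -{1}(mulI o) mulACA. Qed.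
Lemma loro x : lo (ro x) = ro (lo x). Proof. by rewrite loM !mulI. Qed.
Lemma scaleM x y : scale (x * y) = scale x * scale y.
Proof. by rewrite /scale roM loM. Qed.
Lemma scale_o : scale o = o. Proof. by rewrite /scale !mulI. Qed.
Lemma scale_lo x : scale (lo x) = lo (scale x).
Proof. by rewrite /scale -loro. Qed.
Lemma scale_ro x : scale (ro x) = ro (scale x).
Proof. by rewrite /scale -loro. Qed.
Lemma scaddC a b : scadd a b = scadd b a. Proof. exact: mulACA. Qed.
Lemma scadd_morph (f : M -> M) : f o = o -> {morph f : x y / x * y} ->
  {morph f : x y / scadd x y}.
Proof. by move=> fo fM x y; rewrite /scadd !fM fo. Qed.
Lemma scadd0 a : scadd a o = scale a.
Proof. by rewrite /scadd mulI -loro. Qed.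
(** After expansion the middle arguments sit in [(o * b) * o] and [o * (c * o)], of the same form by
    [loro]; one entropic step exchanges them. *)
Lemma scaddACA a b c d : scadd (scadd a b) (scadd c d) = scadd (scadd a c) (scadd b d).
Proof.
have E x y z t : scadd (scadd x y) (scadd z t) =
    ((o * (o * x)) * ((o * y) * o)) * ((o * (z * o)) * ((t * o) * o)).
  rewrite {1}/scadd (scadd_morph (mulI o) loM) (scadd_morph (mulI o) roM).
  by rewrite /scadd.
by rewrite !E mulACA !loro.
Qed.
(** Each [scadd] multiplies its arguments by the factor of [scale]; the lone summand is scaled so
    that all three carry the square of that factor. *)
Lemma scaddA a b c : scadd (scale a) (scadd b c) = scadd (scadd a b) (scale c).
Proof. by rewrite -(scadd0 a) scaddACA [scadd o c]scaddC scadd0. Qed.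
Lemma scadd_half a : scadd (ro a) (lo a) = scale a.
Proof. by rewrite /scadd -loro mulI. Qed.

Lemma iter_morph n (f : M -> M) : {morph f : x y / x * y} ->
  {morph iter n f : x y / x * y}.
Proof. by move=> fM x y; elim: n => //= n ->; rewrite fM. Qed.
Lemma iter_scale_o n : iter n scale o = o.
Proof. by elim: n => //= n ->; rewrite scale_o. Qed.
Lemma iter_scaleD n : {morph iter n scale : x y / scadd x y}.
Proof. by apply: scadd_morph; [exact: iter_scale_o | apply/iter_morph/scaleM]. Qed.
Lemma iter_comm n (f : M -> M) x : (forall x, scale (f x) = f (scale x)) ->
  iter n scale (f x) = f (iter n scale x).
Proof. by move=> H; elim: n => //= n ->. Qed.

(* The pair [(p, n)] stands for [scale^-n p]. *)
Definition loc_rel (x y : M * nat) :=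
  exists k, iter (k + y.2) scale x.1 = iter (k + x.2) scale y.1.

Lemma loc_refl x : loc_rel x x. Proof. by exists 0. Qed.
Lemma loc_sym x y : loc_rel x y -> loc_rel y x.
Proof. by case=> k E; exists k. Qed.
Lemma loc_trans x y z : loc_rel x y -> loc_rel y z -> loc_rel x z.
Proof.
case: x y z => [p n] [q m] [r l] [k /= E] [k' /= E'].
exists (k + k' + m)%N => /=.
rewrite (_ : k + k' + m + l = (k' + l) + (k + m))%N; last first.
  by rewrite (AC (3*1) ((2*4)*(1*3))).
rewrite iterD E -iterD.
rewrite (_ : k' + l + (k + n) = (k + n) + (k' + l))%N; last by rewrite addnC.
rewrite iterD E' -iterD; congr (iter _ _ _).
by rewrite (AC (2*2) ((1*3)*4*2)).
Qed.

Definition loc := quot loc_rel.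
HB.instance Definition _ := gen_eqMixin loc.
HB.instance Definition _ := gen_choiceMixin loc.
Definition frac p n : loc := quot_pi loc_rel (p, n).

Lemma fracP p n q m :
  frac p n = frac q m <-> exists k, iter (k + m) scale p = iter (k + n) scale q.
Proof. exact: (quot_piP loc_refl loc_sym loc_trans). Qed.

Lemma frac_scale k p n : frac (iter k scale p) (k + n) = frac p n.
Proof. by apply/fracP; exists 0; rewrite !add0n addnC iterD. Qed.

Lemma loc_ind (P : loc -> Prop) : (forall p n, P (frac p n)) -> forall x, P x.
Proof. by move=> H x; rewrite -(quot_reprK x); case: (quot_repr x). Qed.

Lemma loc_ind2 (P : loc -> loc -> Prop) :
  (forall p q n, P (frac p n) (frac q n)) -> forall x y, P x y.
Proof.
move=> H; elim/loc_ind => p n; elim/loc_ind => q m.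
by rewrite -(frac_scale m p n) -(frac_scale n q m) addnC.
Qed.

Lemma loc_ind3 (P : loc -> loc -> loc -> Prop) :
  (forall p q r n, P (frac p n) (frac q n) (frac r n)) -> forall x y z, P x y z.
Proof.
move=> H; apply: loc_ind2 => p q n; elim/loc_ind => r m.
rewrite -(frac_scale m p n) -(frac_scale m q n) -(frac_scale n r m) addnC; exact: H.
Qed.

Lemma loc_lift (U : Type) (f : M -> nat -> U) :
  (forall k p n, f (iter k scale p) (k + n) = f p n) ->
  {g : loc -> U | forall p n, g (frac p n) = f p n}.
Proof.
move=> H; exists (fun x => f (quot_repr x).1 (quot_repr x).2) => p n.
have := quot_reprP loc_refl loc_sym loc_trans (p, n).
case: (quot_repr _) => q m [k /= E].
by rewrite -(H (k + n)%N q m) -(H (k + m)%N p n) E addnAC.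
Qed.

(** Cross-scaling gives both numerators the exponent [n + m]; the successor cancels the factor
    introduced by [scadd]. *)
Definition loc_add : loc -> loc -> loc.
apply: sval (loc_lift (f := fun p n => sval (loc_lift (f := fun q m =>
  frac (scadd (iter m scale p) (iter n scale q)) (n + m).+1) _)) _).
- move=> p n k q m /=.
  rewrite -(frac_scale k _ (n + m).+1) iter_scaleD -!iterD [(k + n)%N]addnC.
  by rewrite (_ : (n + (k + m)).+1 = k + (n + m).+1)%N // addnS addnCA.
- move=> H k p n; apply/funext; elim/loc_ind => q m.
  case: loc_lift => g /= ->; case: loc_lift => g' /= ->.
  rewrite -(frac_scale k _ (n + m).+1) iter_scaleD -!iterD [(k + m)%N]addnC.
  by rewrite addnS addnA.
Defined.

Lemma loc_addE p q n : loc_add (frac p n) (frac q n) = frac (scadd p q) n.+1.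
Proof.
rewrite /loc_add; case: loc_lift => g /= ->; case: loc_lift => g' /= ->.
by rewrite -iter_scaleD -addnS frac_scale.
Qed.

Fact loc_addA : associative loc_add.
Proof.
apply: loc_ind3 => p q r n; rewrite !loc_addE.
rewrite -(frac_scale 1 p n) -(frac_scale 1 r n) !add1n !loc_addE /=.
by rewrite scaddA.
Qed.

Fact loc_addC : commutative loc_add.
Proof. by apply: loc_ind2 => p q n; rewrite !loc_addE scaddC. Qed.

Lemma frac_o n : frac o n = frac o 0.
Proof. by apply/fracP; exists 0; rewrite !iter_scale_o. Qed.

Fact loc_add0 : left_id (frac o 0) loc_add.
Proof.
elim/loc_ind => p n; rewrite -(frac_o n) loc_addE scaddC scadd0.
exact: (frac_scale 1).
Qed.

HB.instance Definition _ := GRing.isNmodule.Build loc loc_addA loc_addC loc_add0.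

Lemma loc_map (f : M -> M) : (forall x, scale (f x) = f (scale x)) ->
  {g : loc -> loc | forall p n, g (frac p n) = frac (f p) n}.
Proof. by move=> H; apply: loc_lift => k p n; rewrite -iter_comm // frac_scale. Qed.

Lemma loc_map_morph (f : M -> M) (g : loc -> loc) :
  f o = o -> {morph f : x y / x * y} -> (forall p n, g (frac p n) = frac (f p) n) ->
  g 0%R = 0%R /\ {morph g : x y / (x + y)%R}.
Proof.
move=> fo fM gE; split; first by rewrite [0%R]/(frac o 0) gE fo.
apply: loc_ind2 => p q n; rewrite [(_ + _)%R]loc_addE !gE [RHS]loc_addE.
by rewrite (scadd_morph fo fM).
Qed.

(** A composite of translations, coded as a list so that contexts can be concatenated and compared
    by shape; the head is outermost. *)
Fixpoint ctx (s : seq (bool * M)) x :=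
  if s is (b, v) :: s' then (if b then v * ctx s' x else ctx s' x * v) else x.

Lemma ctx_cat s t x : ctx (s ++ t) x = ctx s (ctx t x).
Proof. by elim: s => //= -[b v] s ->. Qed.

(** In the localization at [scale], [scadd] becomes a true addition, and group completion follows.
    [F] extends [lo], [P] extends [ro], and [H] divides by the scaling factor: [P + F = 1] gives the
    affine form, and [H P F = 1] makes [F] and [1 - F] injective. *)
Lemma affine_group : exists (G : zmodType) (phi : {additive G -> G}) (iota : M -> G),
  [/\ iota o = 0%R,
      forall p q, iota (p * q) = (iota p - phi (iota p) + phi (iota q))%R,
      forall x, phi x = 0%R -> x = 0%R,
      forall x, phi x = x -> x = 0%R
    & forall p, iota p = 0%R -> exists s, ctx s p = ctx s o].
Proof.
have [f fE] := loc_map scale_lo.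
have [g gE] := loc_map scale_ro.
have [f0 fD] := loc_map_morph (mulI o) loM fE.
have [g0 gD] := loc_map_morph (mulI o) roM gE.
have [h hE] : {h : loc -> loc | forall p n, h (frac p n) = frac p n.+1}.
  by apply: loc_lift => k p n; rewrite -addnS frac_scale.
have h0 : h 0%R = 0%R by rewrite [0%R]/(frac o 0) hE frac_o.
have hD : {morph h : x y / (x + y)%R}.
  by apply: loc_ind2 => p q n; rewrite [(_ + _)%R]loc_addE !hE [RHS]loc_addE.
have [F FE] := groth_map f0 fD; have [P PE] := groth_map g0 gD.
have [H HE] := groth_map h0 hD.
have gsub (x : groth loc) : exists a b, x = (groth_in a - groth_in b)%R.
  by elim/groth_ind: x => a b; exists a, b; rewrite groth_subE.
have PF x : (P x + F x)%R = x.
  have E a : (P (groth_in a) + F (groth_in a))%R = groth_in a.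
    rewrite PE FE -groth_inD; congr groth_in; elim/loc_ind: a => p n.
    by rewrite fE gE [LHS]loc_addE scadd_half; apply: (frac_scale 1).
  have [a [b ->]] := gsub x; rewrite !raddfB /= -[in RHS](E a) -[in RHS](E b).
  by rewrite opprD addrACA.
have HPF x : H (P (F x)) = x.
  have [a [b ->]] := gsub x; rewrite !raddfB /=; rewrite !FE !PE !HE.
  have E c : h (g (f c)) = c.
    elim/loc_ind: c => p n; rewrite fE gE hE -loro; exact: (frac_scale 1).
  by rewrite !E.
exists (groth loc), F, (fun p => groth_in (frac p 0)); split=> //.
- move=> p q.
  have -> : (groth_in (frac p 0) - F (groth_in (frac p 0)) = P (groth_in (frac p 0)))%R.
    by rewrite -{1}(PF (groth_in (frac p 0))) addrK.
  rewrite PE FE -groth_inD; congr groth_in; rewrite fE gE [RHS]loc_addE.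
  rewrite -(frac_scale 1 (p * q)) /= scaleM; congr frac.
  by rewrite /scadd /scale -loro.
- by move=> x Fx; rewrite -(HPF x) Fx !raddf0.
- move=> x Fx; have Px : P x = 0%R by rewrite -(addrK (F x) (P x)) PF Fx subrr.
  have := HPF x; rewrite Fx => <-; by rewrite Px raddf0.
(* Vanishing in the completion means equality after adding some common [c], and in the localization
   after scaling; adding [c] and scaling are both contexts. *)
move=> p; rewrite [0%R](_ : _ = groth_in (frac o 0)) // => /groth_inP[].
elim/loc_ind => c n.
rewrite -(frac_scale n p 0) -(frac_scale n o 0) addn0.
rewrite ![(_ + _)%R]loc_addE => /fracP[k].
set K := (k + n.+1)%N => E.
have ctx_scale m x : ctx (flatten (nseq m [:: (true, o); (false, o)])) x = iter m scale x.
  by elim: m => //= m ->.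
exists (flatten (nseq K [:: (true, o); (false, o)]) ++
  [:: (false, c * o); (true, o)] ++ flatten (nseq n [:: (true, o); (false, o)])).
by rewrite !ctx_cat !ctx_scale /= ; exact: E.
Qed.

End Localization.

(** * Ideals of integer polynomials and their reduction modulo primes *)

Section PolynomialIdeals.
Local Open Scope ring_scope.

Definition poly_ideal (I : {poly int} -> Prop) :=
  [/\ I 0, forall P Q, I P -> I Q -> I (P + Q) & forall P Q, I P -> I (Q * P)].

Definition mod_ideal q (I : {poly int} -> Prop) P :=
  exists A B, I A /\ P = A + q%:R * B.

Lemma poly_idealB I P Q : poly_ideal I -> I P -> I Q -> I (P - Q).
Proof. by case=> _ D M IP IQ; apply: D => //; rewrite -mulN1r; apply: M. Qed.

Lemma mod_ideal_ideal q I : poly_ideal I -> poly_ideal (mod_ideal q I).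
Proof.
case=> I0 D M; split.
- by exists 0, 0; split => //; rewrite mulr0 addr0.
- move=> P Q [A [B [IA ->]]] [A' [B' [IA' ->]]].
  exists (A + A'), (B + B'); split; first exact: D.
  by rewrite mulrDr addrACA.
- move=> P Q [A [B [IA ->]]]; exists (Q * A), (Q * B); split; first exact: M.
  by rewrite mulrDr mulrCA.
Qed.

Lemma sub_mod_ideal q I P : I P -> mod_ideal q I P.
Proof. by move=> IP; exists P, 0; rewrite mulr0 addr0. Qed.

Lemma red_eq0 q (P : {poly int}) : prime q ->
  map_poly (intr : int -> 'F_q) P = 0 -> exists B, P = q%:R * B.
Proof.
move=> pq P0; exists (\poly_(i < size P) (P`_i %/ q)%Z).
apply/polyP => i; rewrite -polyC_natr coefCM coef_poly.
have [lt|ge] := ltnP i (size P); last by rewrite mulr0 nth_default.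
have: (map_poly (intr : int -> 'F_q) P)`_i = 0 by rewrite P0 coef0.
rewrite coef_map /= => /eqP.
have chq := pchar_Fp pq.
rewrite -(dvdz_pcharf chq) => /dvdzP[k ->]; rewrite pmulrn.
rewrite mulzK ?eqz_nat -?lt0n ?prime_gt0 //.
by rewrite mulrC; congr (_ * _); rewrite -mulrzr mul1r intz.
Qed.

Lemma red_surj q (P : {poly 'F_q}) :
  exists B : {poly int}, map_poly (intr : int -> 'F_q) B = P.
Proof.
exists (\poly_(i < size P) (nat_of_ord (P`_i)%R)%:Z).
apply/polyP => i; rewrite coef_map coef_poly /=.
have [lt|ge] := ltnP i (size P); last by rewrite nth_default.
by rewrite -pmulrn natr_Zp.
Qed.

(** If [I] contains a positive integer, a prime divisor of the least one works. Otherwise take [P0]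
    of least degree in [I] and a prime [q] above the absolute value of its leading coefficient [c]:
    if 1 were in the enlarged ideal, pseudo-division by [P0] would make a power of [c] a multiple of
    [P0] modulo [q], although [P0] keeps its positive degree. *)
Lemma mod_ideal_proper I P1 : poly_ideal I -> ~ I 1 -> I P1 -> P1 != 0 ->
  exists q, prime q /\ ~ mod_ideal q I 1.
Proof.
move=> idI I1 IP1 nz; have [I0 D M] := idI.
have [[n [n0 In]]|noint] := pselect (exists n, (0 < n)%N /\ I n%:R).
  have ex : exists n, `[< (0 < n)%N /\ I n%:R >] by exists n; apply/asboolP.
  case: (ex_minnP ex) => k /asboolP[k0 Ik] kmin.
  have k1 : k != 1%N by apply/eqP => E; rewrite E in Ik.
  have pk : prime (pdiv k) by apply: pdiv_prime; case: k k0 k1 {Ik kmin} => [|[]].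
  exists (pdiv k); split=> // -[A [B [IA E]]].
  have kE : (k = k %/ pdiv k * pdiv k)%N by rewrite divnK // pdiv_dvd.
  (* Multiplying [1 = A + d B], with [d = pdiv k], by [k / d] puts the smaller integer [k / d] into
     [I]. *)
  have : I (k %/ pdiv k)%:R.
    have -> : (k %/ pdiv k)%:R = (k %/ pdiv k)%:R * A + B * k%:R :> {poly int}.
      rewrite [X in _ + B * X%:R]kE natrM [B * _]mulrC -mulrA -mulrDr -E.
      by rewrite mulr1.
    by apply: D; apply: M.
  move=> Id; have d0 : (0 < k %/ pdiv k)%N.
    by rewrite lt0n; apply: contraTneq k0 => d0; rewrite kE d0.
  have := kmin _ (introT (asboolP _) (conj d0 Id)).
  by rewrite leqNgt ltn_Pdiv // prime_gt1.
have ex : exists n, `[< exists P, [/\ I P, P != 0 & size P = n] >].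
  by exists (size P1); apply/asboolP; exists P1.
case: (ex_minnP ex) => s /asboolP[P0 [IP0 P0nz sP0]] smin.
have s2 : (1 < s)%N.
  rewrite ltnNge; apply/negP => s1.
  have /size1_polyC E : (size P0 <= 1)%N by rewrite sP0.
  apply: noint; exists (absz P0`_0); split.
    by rewrite absz_gt0; apply: contraNneq P0nz => c0; rewrite E c0.
  have -> : (absz P0`_0)%:R = (Num.sg P0`_0)%:P * P0.
    rewrite [in RHS]E -polyCM -polyC_natr coefC /=; congr (_%:P).
    by rewrite -normrEsg -abszE natz.
  exact: M.
pose c := lead_coef P0.
have [q cq pq] := prime_above (absz c).
exists q; split => // -[A [B [IA E]]].


have := Pdiv.Idomain.divp_eq A P0; rewrite -/c.
set k := scalp A P0; set Q := A %/ P0; set R := A %% P0 => EA.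
have IR : I R.
  have -> : R = c ^+ k *: A - Q * P0 by rewrite EA addrC addKr.
  by apply: poly_idealB => //; [rewrite -mul_polyC; apply: M | apply: M].
have R0 : R = 0.
  apply/eqP/negPn/negP => Rn.
  have /smin : `[< exists P, [/\ I P, P != 0 & size P = size R] >].
    by apply/asboolP; exists R.
  by rewrite leqNgt -sP0 ltn_modp P0nz.
rewrite R0 addr0 in EA.
have chq := pchar_Fp pq.
pose red : {poly int} -> {poly 'F_q} := map_poly (intr : int -> 'F_q).
have cn0 : (c%:~R : 'F_q) != 0.
  rewrite -(dvdz_pcharf chq); apply/negP => /dvdzP[d cE].
  have : (absz c < q)%N by [].
  rewrite cE abszM absz_nat.
  have [d0|d0] := eqVneq (absz d) 0%N.
    move: P0nz; rewrite -lead_coef_eq0 -/c cE.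
    by move/eqP: d0; rewrite absz_eq0 => /eqP ->; rewrite mul0r eqxx.
  by rewrite ltnNge leq_pmull // lt0n.
have E2 : (c ^+ k)%:P = Q * P0 + q%:R * (c ^+ k *: B).
  rewrite -EA -scalerAr -scalerDr -E -mul_polyC mulr1 //.
have: red (c ^+ k)%:P = red (Q * P0 + q%:R * (c ^+ k *: B)) by rewrite E2.
rewrite /red rmorphD !rmorphM /= rmorph_nat.
have -> : (q%:R : {poly 'F_q}) = 0.
  by rewrite -polyC_natr pchar_Fp_0 // polyC0.
rewrite mul0r addr0 map_polyC /= rmorphXn /= => Ered.
have sz : size (map_poly (intr : int -> 'F_q) P0) = s.
  by rewrite size_poly_eq.
have: size ((c%:~R ^+ k)%:P : {poly 'F_q}) = 1%N.
  by rewrite size_polyC expf_neq0.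
rewrite Ered; have [->|Qn] := eqVneq (map_poly (intr : int -> 'F_q) Q) 0.
  by rewrite mul0r size_poly0.
have P0n : map_poly (intr : int -> 'F_q) P0 != 0 by rewrite -size_poly_gt0 sz ltnW.
rewrite size_mul // sz => E3.
have: (0 < size (map_poly (intr : int -> 'F_q) Q))%N by rewrite size_poly_gt0.
case: (size (map_poly (intr : int -> 'F_q) Q)) E3 => // a; rewrite addSn /= => E4 _.
by move: (leq_addl a s); rewrite E4 leqNgt s2.
Qed.

(** Pigeonhole: over a finite field the powers of ['X] have finitely many remainders modulo [p], and
    a coincidence lifts back to the integers up to a multiple of [q]. *)
Lemma power_collision q I P1 : prime q -> poly_ideal I -> I P1 ->
  map_poly (intr : int -> 'F_q) P1 != 0 ->
  exists i k, (0 < k)%N /\ mod_ideal q I ('X^i * (1 - 'X^k)).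
Proof.
move=> pq idI IP1 nz; set p := map_poly _ P1 in nz; have [_ _ M] := idI.
pose h (i : 'I_#|'rV['F_q]_(size p)|.+1) : 'rV['F_q]_(size p) :=
  poly_rV ('X^i %% p).
have /injectivePn[i [j ij hij]] : ~~ injectiveb h.
  by apply/negP => /injectiveP/leq_card; rewrite card_ord ltnn.
have {hij} Eij : 'X^i %% p = 'X^j %% p.
  have sz k : (size ('X^k %% p)%R <= size p)%N by rewrite ltnW // ltn_modp.
  by rewrite -[LHS](poly_rV_K (sz i)) -[RHS](poly_rV_K (sz j)); congr rVpoly.
wlog lt : i j ij Eij / (i < j)%N.
  move=> W; have [lt|lt|E] := ltngtP i j; first exact: (W i j).
    by apply: (W j i); rewrite 1?eq_sym.
  by move/eqP: ij; case; apply: val_inj.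
exists i, (j - i)%N; split; first by rewrite subn_gt0.
have [Q EQ] := red_surj (('X^i %/ p) - ('X^j %/ p)).
have /(red_eq0 pq)[B EB] :
    map_poly (intr : int -> 'F_q) ('X^i * (1 - 'X^(j - i)) - Q * P1) = 0.
  rewrite mulrBr mulr1 -exprD subnKC ?(ltnW lt) //.
  rewrite !rmorphB rmorphM /= EQ !map_polyXn.
  rewrite {1}(divp_eq 'X^i p) {1}(divp_eq 'X^j p) Eij mulrBl.
  by rewrite opprD addrACA subrr addr0 subrr.
exists (Q * P1), B; split; first exact: M.
by rewrite -EB [RHS]addrC subrK.
Qed.

(* Modulo a suitable prime the quotient ring is finite and nonzero, so the unit [X] has a finite multiplicative order
   [k]; the last hypothesis for this [k] makes [X] congruent to [F.[1]], that is to 0 or 1, although [X] and [1 - X]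
   are units. *)
Lemma no_exceptional_unit I : poly_ideal I ->
  (exists U, I (1 - 'X * U)) -> (exists V, I (1 - (1 - 'X) * V)) ->
  (forall k, (0 < k)%N -> exists F, I ('X - (F \Po 'X^k)) /\ (F.[1] = 0 \/ F.[1] = 1)) ->
  I 1.
Proof.
move=> idI [U IU] [V IV] rel; apply: contrapT => I1.
have [F2 [IF2 _]] := rel 2 isT.
(* Substituting ['X^2] produces no term of degree 1, so this element of [I] has coefficient 1 at
   ['X] and stays nonzero modulo every prime. *)
have c1 : ('X - (F2 \Po 'X^2))`_1 = 1.
  rewrite coefB coefX /= comp_polyE coef_sum big1 ?subr0 // => i _.
  rewrite coefZ -exprM coefXn; case: (val i) => [|n]; first by rewrite mulr0.
  by rewrite mulnS mulr0.
have nz : 'X - (F2 \Po 'X^2) != 0.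
  by apply/eqP => E; move: c1; rewrite E coef0.
have [q [pq q1]] := mod_ideal_proper idI I1 IF2 nz.
have idq := mod_ideal_ideal q idI; have [_ D M] := idq.
have nzq : map_poly (intr : int -> 'F_q) ('X - (F2 \Po 'X^2)) != 0.
  apply/eqP => E; have := congr1 (fun P : {poly 'F_q} => P`_1) E.
  by rewrite coef_map c1 coef0 /= => /eqP; rewrite oner_eq0.
have [i [k [k0 Ik]]] := power_collision pq idI IF2 nzq.
have unit_pow j : mod_ideal q I (1 - ('X * U) ^+ j).
  have -> : 1 - ('X * U) ^+ j = (\sum_(l < j) ('X * U) ^+ l) * (1 - 'X * U).
    by rewrite [RHS]mulrC -[RHS]opprK -mulNr opprB -subrX1 opprB.
  by apply: M; apply: sub_mod_ideal.
have {}Ik : mod_ideal q I (1 - 'X^k).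
  have -> : 1 - 'X^k = (1 - 'X^k) * (1 - ('X * U) ^+ i) + U ^+ i * ('X^i * (1 - 'X^k)).
    rewrite exprMn; ring.
  by apply: D; apply: M.
have [F [IF F1]] := rel k k0.
have IX : mod_ideal q I ('X - F.[1]%:P).
  have /factor_theorem[Q EQ] : root (F - F.[1]%:P) 1.
    by rewrite rootE !hornerE subrr.
  have -> : 'X - F.[1]%:P = ('X - (F \Po 'X^k)) - (Q \Po 'X^k) * (1 - 'X^k).
    have EF : (F \Po 'X^k) = F.[1]%:P + (Q \Po 'X^k) * ('X^k - 1).
      rewrite -{1}[F](subrK F.[1]%:P) EQ comp_polyD comp_polyM comp_polyB.
      by rewrite comp_polyX !comp_polyC addrC.
    by rewrite EF -mulrN opprB opprD addrA subrK.
  by apply: poly_idealB => //; [apply: sub_mod_ideal | apply: M].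
apply: q1; case: F1 IX => ->.
  rewrite polyC0 subr0 => IX.
  have -> : 1 = (1 - 'X * U) + U * 'X by rewrite [U * _]mulrC subrK.
  by apply: D; [apply: sub_mod_ideal | apply: M].
rewrite polyC1 => IX.
have -> : 1 = (1 - (1 - 'X) * V) + (- V) * ('X - 1).
  ring.
by apply: D; [apply: sub_mod_ideal | apply: M].
Qed.
End PolynomialIdeals.

(** * Integer polynomials acting through an endomorphism *)

Section PolynomialAction.
Local Open Scope ring_scope.
Variables (G : zmodType) (phi : {additive G -> G}).

Definition act (P : {poly int}) (g : G) := \sum_(i < size P) iter i phi g *~ P`_i.

Lemma act_widen N (P : {poly int}) g : (size P <= N)%N ->
  act P g = \sum_(i < N) iter i phi g *~ P`_i.
Proof.
move=> sN; rewrite /act (big_ord_widen N (fun i => iter i phi g *~ P`_i)) //.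
rewrite big_mkcond; apply: eq_bigr => i _; case: ltnP => // sP.
by rewrite nth_default // mulr0z.
Qed.

Lemma act0p g : act 0 g = 0.
Proof. by rewrite /act size_poly0 big_ord0. Qed.

Lemma actC c g : act c%:P g = g *~ c.
Proof.
rewrite (@act_widen 1) ?size_polyC ?leq_b1 //.
by rewrite big_ord_recl big_ord0 addr0 coefC.
Qed.

Lemma act1 g : act 1 g = g.
Proof. by rewrite -polyC1 actC. Qed.

Lemma actDp P Q g : act (P + Q) g = act P g + act Q g.
Proof.
set N := maxn (size P) (size Q).
rewrite (@act_widen N (P + Q)) ?size_polyD //.
rewrite (@act_widen N P) ?leq_maxl // (@act_widen N Q) ?leq_maxr //.
by rewrite -big_split; apply: eq_bigr => i _; rewrite coefD mulrzDr.
Qed.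

Lemma iter_phiB n : {morph iter n phi : x y / x - y}.
Proof. by move=> x y; elim: n => //= n ->; rewrite raddfB. Qed.

Lemma actB P : {morph act P : x y / x - y}.
Proof.
move=> x y; rewrite /act -sumrB; apply: eq_bigr => i _.
by rewrite iter_phiB mulrzBl.
Qed.

Lemma act0 P : act P 0 = 0.
Proof. by rewrite -[X in act P X](subrr 0) actB subrr. Qed.

Lemma actD P : {morph act P : x y / x + y}.
Proof. by move=> x y; have := actB P (x + y) y; rewrite addrK => ->; rewrite subrK. Qed.

Lemma act_sum P I (r : seq I) (F : I -> G) :
  act P (\sum_(i <- r) F i) = \sum_(i <- r) act P (F i).
Proof. exact: (big_morph _ (actD P) (act0 P)). Qed.

Lemma act_sump I (r : seq I) (F : I -> {poly int}) g :
  act (\sum_(i <- r) F i) g = \sum_(i <- r) act (F i) g.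
Proof. by apply: (big_morph (act^~ g)) => [P Q|]; rewrite ?actDp ?act0p. Qed.

Lemma act_mulX P g : act (P * 'X) g = phi (act P g).
Proof.
rewrite (@act_widen (size P).+1); last first.
  by apply: leq_trans (size_polyMleq _ _) _; rewrite size_polyX addn2.
rewrite big_ord_recl coefMX eqxx mulr0z add0r /act raddf_sum.
by apply: eq_bigr => i _; rewrite coefMX /= raddfMz.
Qed.

Lemma actM P Q g : act (P * Q) g = act P (act Q g).
Proof.
elim/poly_ind: P => [|P c IH]; first by rewrite mul0r !act0p.
rewrite mulrDl !actDp mulrAC !act_mulX IH; congr (_ + _).
rewrite mul_polyC actC (@act_widen (size Q)) ?size_scale_leq // /act mulrz_suml.
by apply: eq_bigr => i _; rewrite coefZ -mulrzA mulrC.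
Qed.

Lemma actN P g : act (- P) g = - act P g.
Proof. by rewrite -mulN1r actM -polyCN actC mulrN1z. Qed.

Lemma actBp P Q g : act (P - Q) g = act P g - act Q g.
Proof. by rewrite actDp actN. Qed.

Lemma actX g : act 'X g = phi g.
Proof. by rewrite -['X]mul1r act_mulX act1. Qed.

Definition annihilator g (P : {poly int}) := act P g = 0.

Lemma annihilator_ideal g : poly_ideal (annihilator g).
Proof.
split; rewrite /annihilator; first exact: act0p.
  by move=> P Q E F; rewrite actDp E F addr0.
by move=> P Q E; rewrite actM E act0.
Qed.

Lemma comp_ideal (I : {poly int} -> Prop) S :
  poly_ideal I -> poly_ideal (fun P => I (P \Po S)).
Proof.
case=> I0 ID IM; split; first by rewrite comp_poly0.
  by move=> P Q IP IQ; rewrite comp_polyD; apply: ID.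
by move=> P Q IP; rewrite comp_polyM; apply: IM.
Qed.

(** Splitting off the constant term, [F \Po S ^+ 2] is [F.[0]] plus [T * S ^+ 2]. For constant term
    0 the relation is [S * (1 - S * T)] and [S] cancels; for constant term 1 the inverse is
    [1 - S * T]. *)
Lemma unit_of_square (I : {poly int} -> Prop) S F : poly_ideal I ->
  (forall P, I (S * P) -> I P) -> I (S - (F \Po S ^+ 2)) ->
  F.[0] = 0 \/ F.[0] = 1 -> exists U, I (1 - S * U).
Proof.
move=> [I0 ID IM] sat IF F0.
have /factor_theorem[Q EQ] : root (F - F.[0]%:P) 0 by rewrite rootE !hornerE subrr.
have EF : F \Po S ^+ 2 = F.[0]%:P + (Q \Po S ^+ 2) * S ^+ 2.
  rewrite -{1}[F](subrK F.[0]%:P) EQ comp_polyD comp_polyM comp_polyB.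
  by rewrite comp_polyX !comp_polyC polyC0 subr0 addrC.
move: IF; rewrite EF; set T := Q \Po S ^+ 2; case: F0 => -> IF.
  exists T; apply: sat; move: IF; congr I; rewrite polyC0; ring.
exists (1 - S * T); have := IM _ (-1) IF; congr I; rewrite polyC1; ring.
Qed.

End PolynomialAction.

Definition two (T : Type) (x y : T) : 'I_2 -> T :=
  fun i => if i == ord0 then x else y.

Definition three (T : Type) (x y z : T) : 'I_3 -> T :=
  fun i => if i == ord0 then x else if i == ord_max then z else y.

Lemma two_eta (T : Type) (v : 'I_2 -> T) : v = two (v ord0) (v ord_max).
Proof.
apply/funext => l; rewrite /two; have [->//|l0] := eqVneq l ord0.
by congr v; apply: val_inj; case: l l0 => -[|[]].
Qed.

Lemma three1 (T : Type) (x y z : T) : three x y z (inord 1) = y.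
Proof. by rewrite /three -!val_eqE /= !inordK. Qed.

(** * Matrices of operations and the corner condition *)

Section Representation.
Variables (C : clone) (A : Type) (rho : representation C A).

Lemma rep_proj n (i : 'I_n.+1) z : rho n (cproj i) z = z i.
Proof. by rewrite chom_proj. Qed.

Lemma rep_comp n m (f : C n) (g : 'I_n.+1 -> C m) z :
  rho m (ccomp f g) z = rho n f (fun i => rho m (g i) z).
Proof. by rewrite chom_comp. Qed.

Definition mix n (b : 'I_n -> bool) (r c : 'I_n -> A) : 'I_n -> A :=
  fun l => if b l then r l else c l.

(* No constants are needed: they may be counted among the row variables, with equal values in both rows. *)
Definition corner_condition :=
  forall n (h : C n) (b : 'I_n.+1 -> bool) (r c : bool -> 'I_n.+1 -> A) u,
    rho n h (mix b (r false) (c false)) = u ->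
    rho n h (mix b (r false) (c true)) = u ->
    rho n h (mix b (r true) (c false)) = u ->
    rho n h (mix b (r true) (c true)) = u.

(** Entries are indexed by row, then column. Generation from matrices depending on the row or the
    column alone lets proofs assemble matrices term by term. *)
Inductive corner_matrix : (bool -> bool -> A) -> Prop :=
| corner_row (r : bool -> A) : corner_matrix (fun i _ => r i)
| corner_col (c : bool -> A) : corner_matrix (fun _ j => c j)
| corner_op n (h : C n) (m : 'I_n.+1 -> bool -> bool -> A) :
    (forall l, corner_matrix (m l)) ->
    corner_matrix (fun i j => rho n h (fun l => m l i j)).

Lemma weakly_abelian_corner :
  weakly_abelian (rep_algebra rho) -> corner_condition.
Proof.
move=> wab n h b r c u e00 e01 e10.
apply/esym/wab.
pose t : operation A (n.+1 + n.+1) := fun x =>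
  rho n h (fun l => if b l then x (lshift n.+1 l) else x (rshift n.+1 l)).
exists n.+1, n.+1, t, (r false), (r true), (c false), (c true).
have tE a d : t (vcat a d) = rho n h (mix b a d).
  rewrite /t; congr (rho n h _); apply/funext => l; rewrite /mix /vcat.
  have -> : split (lshift n.+1 l) = inl l by apply: (unsplitK (inl l)).
  have -> : split (rshift n.+1 l) = inr l by apply: (unsplitK (inr l)).
  by [].
rewrite !tE e00 e01 e10; split=> //.
pose g (l : 'I_n.+1) : operation A (n.+1 + n.+1) :=
  fun x => if b l then x (lshift n.+1 l) else x (rshift n.+1 l).
apply: (@poly_basic (rep_algebra rho) _ (existT _ n h) g) => l.
rewrite /g; case: (b l); exact: poly_proj.
Qed.

Lemma corner_matrixP m : corner_matrix m ->
  exists n (h : C n) (b : 'I_n.+1 -> bool) (r c : bool -> 'I_n.+1 -> A),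
    forall i j, m i j = rho n h (mix b (r i) (c j)).
Proof.
elim=> {m} [r|c|k h m _ IH].
- exists 0, (cproj ord0), (fun=> true), (fun i _ => r i), (fun i _ => r i) => i j.
  by rewrite rep_proj.
- exists 0, (cproj ord0), (fun=> false), (fun i _ => c i), (fun i _ => c i) => i j.
  by rewrite rep_proj.
pose Q l (w : {n : nat & (C n * ('I_n.+1 -> bool) *
  (bool -> 'I_n.+1 -> A) * (bool -> 'I_n.+1 -> A))%type}) :=
  forall i j, m l i j = rho _ (projT2 w).1.1.1
    (mix (projT2 w).1.1.2 ((projT2 w).1.2 i) ((projT2 w).2 j)).
have /choice[W WP] : forall l, exists w, Q l w.
  by move=> l; have [n [h' [b [r [c E]]]]] := IH l; exists (existT _ n (h', b, r, c)).
(* A variable of the composite is an argument [l] of [h] together with a variable of its term;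
   numbering such pairs lets each keep its own side and values. *)
pose T : finType := {l : 'I_k.+1 & 'I_(projT1 (W l)).+1}.
pose t0 : T := Tagged (fun l => 'I_(projT1 (W l)).+1) (ord0 : 'I_(projT1 (W ord0)).+1).
have cT : #|T|.-1.+1 = #|T| by rewrite prednK //; apply/card_gt0P; exists t0.
pose rk (t : T) : 'I_#|T|.-1.+1 := cast_ord (esym cT) (enum_rank t).
pose vl (v : 'I_#|T|.-1.+1) : T := enum_val (cast_ord cT v).
have rkK t : vl (rk t) = t by rewrite /vl /rk cast_ordKV enum_rankK.
exists #|T|.-1, (ccomp h (fun l => ccomp (projT2 (W l)).1.1.1
  (fun s => cproj (rk (Tagged (fun l => 'I_(projT1 (W l)).+1) s))))).
exists (fun v => (projT2 (W (tag (vl v)))).1.1.2 (tagged (vl v))).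
exists (fun i v => (projT2 (W (tag (vl v)))).1.2 i (tagged (vl v))).
exists (fun j v => (projT2 (W (tag (vl v)))).2 j (tagged (vl v))).
move=> i j; rewrite rep_comp; congr (rho k h _); apply/funext => l.
rewrite rep_comp WP; congr (rho _ _ _); apply/funext => s.
by rewrite rep_proj /mix rkK.
Qed.

Lemma corner_weakly_abelian :
  corner_condition -> weakly_abelian (rep_algebra rho).
Proof.
move=> cc u v [n [m [t [a [b [c [d [pt [e1 e2] [e3 e4]]]]]]]]].
suff /corner_matrixP[k [h [s [rr [cl E]]]]] : corner_matrix (fun i j =>
    t (vcat (if i then b else a) (if j then d else c))).
  rewrite e4 (E true true); symmetry; apply: cc.
  - by rewrite -(E false false).
  - by rewrite -(E false true).
  - by rewrite -(E true false).
elim: pt {e1 e2 e3 e4} => [i|e|s g _ IH].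
- rewrite /vcat; case: (split i) => l.
    by apply: (corner_row (fun i => (if i then b else a) l)).
  by apply: (corner_col (fun i => (if i then d else c) l)).
- exact: (corner_row (fun=> e)).
- exact: (@corner_op _ (projT2 s) (fun l i j =>
    g l (vcat (if i then b else a) (if j then d else c)))).
Qed.

Lemma corner_conditionP m u : corner_condition -> corner_matrix m ->
  m false false = u -> m false true = u -> m true false = u -> m true true = u.
Proof.
move=> cc /corner_matrixP[n [h [b [r [c E]]]]].
by rewrite !E; apply: cc.
Qed.

Lemma corner_two (f : C 1) m1 m2 : corner_matrix m1 -> corner_matrix m2 ->
  corner_matrix (fun i j => rho 1 f (two (m1 i j) (m2 i j))).
Proof.
move=> M1 M2.
have -> : (fun i j => rho 1 f (two (m1 i j) (m2 i j))) =
    (fun i j => rho 1 f (fun l => two m1 m2 l i j)).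
  apply/funext => i; apply/funext => j; congr (rho 1 f _); apply/funext => l.
  by rewrite /two; case: ifP.
by apply: corner_op => l; rewrite /two; case: ifP.
Qed.

Lemma corner_three (p : C 2) m1 m2 m3 :
  corner_matrix m1 -> corner_matrix m2 -> corner_matrix m3 ->
  corner_matrix (fun i j => rho 2 p (three (m1 i j) (m2 i j) (m3 i j))).
Proof.
move=> M1 M2 M3.
have -> : (fun i j => rho 2 p (three (m1 i j) (m2 i j) (m3 i j))) =
    (fun i j => rho 2 p (fun l => three m1 m2 m3 l i j)).
  apply/funext => i; apply/funext => j; congr (rho 2 p _); apply/funext => l.
  by rewrite /three; case: ifP => // _; case: ifP.
by apply: corner_op => l; rewrite /three; case: ifP => // _; case: ifP.
Qed.

End Representation.

(** * Transfer of absorption identities in a minimal clone *)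

Section Minimal.
Variable C : clone.
Hypothesis hC : minimal_clone C.

(** Minimality as an induction principle: a property defining a subclone need only be checked on one
    nonprojection. *)
Lemma minimal_generated (S : forall n, C n -> Prop) n (h : C n) :
  is_subclone S -> S n h -> ~ is_projection h -> forall m (k : C m), S m k.
Proof.
move=> SS Sh nh; have [_ /(_ S SS)[E|//]] := hC.
by case: nh; apply/E.
Qed.

Lemma comp_ext n m (f : C n) (g g' : 'I_n.+1 -> C m) :
  (forall i, g i = g' i) -> ccomp f g = ccomp f g'.
Proof. by move=> E; congr (ccomp f _); apply/funext. Qed.

Section Nontrivial.
Variables (A : Type) (rho : representation C A).
Hypothesis nontriv : ~ trivial_algebra (rep_algebra rho).

Lemma term_op_rep n (f : operation A n.+1) :
  @term_op (rep_algebra rho) n.+1 f -> exists h : C n, f = rho n h.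
Proof.
elim=> [i|s g _ IH]; first by exists (cproj i); rewrite chom_proj.
have [h hE] := choice IH.
exists (ccomp (projT2 s) h); rewrite chom_comp; apply/funext => x /=.
by congr (rho _ _ _); apply/funext => i; rewrite hE.
Qed.

Lemma exists_nonprojection : exists n (h : C n), ~ is_projection (rho n h).
Proof.
apply: contrapT => H; apply: nontriv => n f /term_op_rep[h ->].
by apply: contrapT => Hn; apply: H; exists n, h.
Qed.

Lemma exists_distinct : exists a b : A, a <> b.
Proof.
have [n [h hn]] := exists_nonprojection.
apply: contrapT => H; apply: hn; exists ord0; apply/funext => x.
by apply: contrapT => Hn; apply: H; exists (rho n h x), (x ord0).
Qed.

(** Otherwise [h] generates [C], so every element acts on [A] as a projection, against
    nontriviality. Two distinct points of [A] determine the index. *)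
Lemma absorption n (h : C n) i : (forall z, rho n h z = z i) -> h = cproj i.
Proof.
move=> hE.
suff [j E] : is_projection h.
  rewrite E; congr cproj; apply: contrapT => /eqP ij.
  have [a [b ab]] := exists_distinct; apply: ab.
  have := hE (fun k => if k == i then a else b).
  by rewrite E rep_proj eqxx (negPf ij).
apply: contrapT => nh.
have [m [k nk]] := exists_nonprojection; apply: nk.
apply: (@minimal_generated (fun m k => is_projection (rho m k)) n h) => //.
  split=> [l j|l m' f g [j fE] gE]; first by exists j; rewrite chom_proj.
  have [j' gE'] := gE j; exists j'.
  by rewrite chom_comp fE /= gE'.
by exists i; apply/funext => z; rewrite hE.
Qed.

Lemma nonprojection n (h : C n) : ~ is_projection h -> forall i, ~ forall z, rho n h z = z i.
Proof. by move=> nh i hE; apply: nh; exists i; apply: absorption. Qed.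

End Nontrivial.

(** An expression is written for all representations at once and realized by one element of [C], so
    that identities can be carried from [A] to [B]. *)
Definition uniform n (F : forall A : Type, representation C A -> ('I_n.+1 -> A) -> A) :=
  exists h : C n, forall (A : Type) (rho : representation C A) z, rho n h z = F A rho z.

Lemma uniform_var n (i : 'I_n.+1) : uniform (fun A rho z => z i).
Proof. by exists (cproj i) => A rho z; rewrite rep_proj. Qed.

Lemma uniform_op n k (h : C k) (F : 'I_k.+1 -> forall A : Type, representation C A -> ('I_n.+1 -> A) -> A) :
  (forall l, uniform (F l)) ->
  uniform (fun A (rho : representation C A) z => rho k h (fun l => F l A rho z)).
Proof.
move=> H; have [g gE] := choice H; exists (ccomp h g) => A rho z.
by rewrite rep_comp; congr (rho k h _); apply/funext => l; rewrite gE.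
Qed.

Definition binop (f : C 1) (A : Type) (rho : representation C A) x y := rho 1 f (two x y).

Lemma uniform_binop n f F G : @uniform n F -> @uniform n G ->
  uniform (fun A rho z => binop f rho (F A rho z) (G A rho z)).
Proof.
move=> [g gE] [h hE]; exists (ccomp f (two g h)) => A rho z.
rewrite rep_comp /binop; congr (rho 1 f _); apply/funext => l.
by rewrite /two; case: ifP; rewrite ?gE ?hE.
Qed.

Lemma uniform_absorption n F (A : Type) (rho : representation C A) i : @uniform n F ->
  ~ trivial_algebra (rep_algebra rho) -> (forall z, F A rho z = z i) ->
  forall (B : Type) (sigma : representation C B) z, F B sigma z = z i.
Proof.
move=> [h hE] nt FA B sigma z; rewrite -hE.
by rewrite (absorption nt (i := i) (h := h)) ?rep_proj // => y; rewrite hE.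
Qed.

(** Every element is a unary operation applied to one variable; as this variable lies on one side
    only, the fourth corner repeats a known one. *)
Lemma unary_generated (g : C 0) : ~ is_projection g ->
  forall (B : Type) (sigma : representation C B), weakly_abelian (rep_algebra sigma).
Proof.
move=> ng B sigma; apply: corner_weakly_abelian => n h b r c u.
have [i [k ->]] : exists i (k : C 0), h = ccomp k (fun=> cproj i).
  apply: (@minimal_generated (fun n h => exists i (k : C 0), h = ccomp k (fun=> cproj i)) 0 g) => //; last first.
    by exists ord0, g; rewrite -[LHS]ccomp_id; apply: comp_ext => i; rewrite ord1.
  split=> [m i|m m' f g' [i [k ->]] H]; first by exists i, (cproj ord0); rewrite ccomp_proj.
  have [j [l E]] := H i; exists j, (ccomp k (fun=> l)).
  rewrite !ccompA; apply: comp_ext => s.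
  by rewrite ccomp_proj E.
rewrite !rep_comp.
have E z : (fun _ : 'I_1 => sigma n (cproj i) z) = fun=> z i.
  by apply/funext => s; rewrite rep_proj.
by rewrite !E /mix; case: (b i).
Qed.

Lemma maltsev_weakly_abelian (p : C 2) (A : Type) (rho : representation C A) :
  ~ trivial_algebra (rep_algebra rho) -> weakly_abelian (rep_algebra rho) ->
  (forall x y, rho 2 p (three x y y) = x) -> (forall x y, rho 2 p (three x x y) = y) ->
  forall (B : Type) (sigma : representation C B), weakly_abelian (rep_algebra sigma).
Proof.
move=> nt wab p1 p2 B sigma; apply: corner_weakly_abelian => n h b r c u e00 e01 e10.
have cc := weakly_abelian_corner wab.
have lift3 m (F : forall D : Type, representation C D -> ('I_m.+1 -> D) -> D) i :
    uniform F -> (forall z, F A rho z = z i) -> forall z, F B sigma z = z i.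
  by move=> E H z; apply: (uniform_absorption E nt H).
pose p3 (D : Type) (tau : representation C D) x y z := tau 2 p (three x y z).
have up3 m F1 F2 F3 : @uniform m F1 -> @uniform m F2 -> @uniform m F3 ->
    @uniform m (fun D tau z => p3 D tau (F1 D tau z) (F2 D tau z) (F3 D tau z)).
  move=> [g1 E1] [g2 E2] [g3 E3]; exists (ccomp p (three g1 g2 g3)) => D tau z.
  rewrite rep_comp /p3; congr (tau 2 p _); apply/funext => l.
  by rewrite /three; case: ifP => // _; case: ifP.
(* [p (h (b, d)) (p (h (b, c)) (h (a, c)) (h (a, d))) w = w] holds in [A], since three corners are equal to [w]; as
   an absorption identity it holds in [B] too. The variables [ix 0], [ix 1], [ix 2], [ix 3] are those of [a], [b], [c],
   [d], and [ord_max] is [w]. *)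
pose N := (4 * n.+1)%N.
pose ix (t : 'I_4) (l : 'I_n.+1) : 'I_N.+1 := inord (t * n.+1 + l).
have ixK t l : val (ix t l) = (t * n.+1 + l)%N.
  rewrite /ix /= inordK // ltnS /N.
  apply: leq_trans (_ : t.+1 * n.+1 <= _)%N; last by rewrite leq_mul2r ltn_ord orbT.
  by rewrite mulSn addnC leq_add2r ltnW.
pose q D (tau : representation C D) (z : 'I_N.+1 -> D) (i j : bool) : D :=
  tau n h (fun l => if b l then z (ix (if i then inord 1 else inord 0) l)
                    else z (ix (if j then inord 3 else inord 2) l)).
pose F D (tau : representation C D) (z : 'I_N.+1 -> D) : D :=
  p3 D tau (q D tau z true true)
    (p3 D tau (q D tau z true false) (q D tau z false false) (q D tau z false true))
    (z ord_max).
have uq i j : uniform (fun D (tau : representation C D) (z : 'I_N.+1 -> D) => q D tau z i j).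
  rewrite /q; apply: (@uniform_op _ _ h (fun l D tau z => if b l then z (ix (if i then inord 1 else inord 0) l)
                    else z (ix (if j then inord 3 else inord 2) l))) => l.
  by case: (b l); apply: uniform_var.
have uF : uniform F.
  by apply: (up3); [exact: uq | apply: (up3); exact: uq | exact: uniform_var].
have FA z : F A rho z = z ord_max.
  (* The indices [i] and [j] switch on the passage from [a] to [b] and from [c] to [d]; unless both
     are on, the first two arguments of the outer [p] coincide and the value is [w]. *)
  pose qm (i j i' j' : bool) : A := rho n h (fun l =>
    if b l then z (ix (if i && i' then inord 1 else inord 0) l)
    else z (ix (if j && j' then inord 3 else inord 2) l)).
  pose m (i j : bool) : A := p3 A rho (qm i j true true)
    (p3 A rho (qm i j true false) (qm i j false false) (qm i j false true)) (z ord_max).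
  apply: (corner_conditionP (m := m) cc).
  - have Mq i' j' : corner_matrix rho (fun i j => qm i j i' j').
      apply: (@corner_op _ _ _ _ h (fun l i j => if b l then z (ix (if i && i' then inord 1 else inord 0) l)
        else z (ix (if j && j' then inord 3 else inord 2) l))) => l.
      case: (b l); first by apply: (corner_row _ (fun i => z (ix (if i && i' then inord 1 else inord 0) l))).
      by apply: (corner_col _ (fun j => z (ix (if j && j' then inord 3 else inord 2) l))).
    apply: corner_three => //; first exact: corner_three.
    exact: (corner_row rho (fun=> z ord_max)).
  - by rewrite /m /p3 p1 p2.
  - by rewrite /m /p3 p2 p2.
  - by rewrite /m /p3 p1 p2.
have FB := lift3 _ _ _ uF FA.
pose z0 (v : 'I_N.+1) : B := if v == ord_max then u else
  let t := (v %/ n.+1)%N in let l : 'I_n.+1 := inord (v %% n.+1) in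
  if t == 0%N then r false l else if t == 1%N then r true l else if t == 2 then c false l else c true l.
have z0E (t : 'I_4) l : z0 (ix t l) =
    if val t == 0%N then r false l else if val t == 1%N then r true l
    else if val t == 2 then c false l else c true l.
  have ne : ix t l != ord_max.
    rewrite -val_eqE /= ixK neq_ltn /N; apply/orP; left.
    apply: leq_trans (_ : t.+1 * n.+1 <= _)%N; last by rewrite leq_mul2r ltn_ord orbT.
    by rewrite mulSn addnC ltn_add2r.
  rewrite /z0 (negPf ne) ixK divnMDl // divn_small // addn0.
  rewrite modnMDl modn_small //.
  by have -> : inord l = l :> 'I_n.+1 by apply: val_inj; rewrite /= inordK.
have qE i j : q B sigma z0 i j = sigma n h (mix b (r i) (c j)).
  rewrite /q; congr (sigma n h _); apply/funext => l; rewrite /mix.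
  by case: i j => [] []; case: (b l); rewrite z0E /= !inordK.
have := FB z0; rewrite /F !qE e00 e01 e10.
have pu x y : p3 B sigma x y y = x.
  have U : @uniform 1 (fun D tau z => p3 D tau (z ord0) (z ord_max) (z ord_max)).
    by apply: up3; apply: uniform_var.
  have H : forall z, p3 A rho (z (ord0 : 'I_2)) (z ord_max) (z ord_max) = z ord0 by move=> z; apply: p1.
  exact: (uniform_absorption U nt H sigma (two x y)).
by rewrite pu /z0 eqxx pu.
Qed.

End Minimal.

(** * Clones without nontrivial binary operations *)

Section NoBinary.
Variable C : clone.
Hypothesis hC : minimal_clone C.
Variables (A : Type) (rho : representation C A).
Hypothesis nontriv : ~ trivial_algebra (rep_algebra rho).
Hypothesis wab : weakly_abelian (rep_algebra rho).

(* Let [h] have minimal arity among the nonprojections, and call a set [b] of variables large when [h] takes the value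
   [x] whenever the variables in [b] are [x] and the others are [y]. Either two large sets are disjoint and [h] yields a
   Maltsev operation, or some singleton is large and [h] is a semiprojection; the corner condition makes a
   semiprojection trivial. *)
Lemma no_binary_weakly_abelian : (forall h : C 1, is_projection h) ->
  forall (B : Type) (sigma : representation C B), weakly_abelian (rep_algebra sigma).
Proof.
move=> triv1.
have cc := weakly_abelian_corner wab.
have [a0 [b0 ab0]] := exists_distinct nontriv.
have ex : exists n, `[< exists h : C n, ~ is_projection h >].
  have [n [h hn]] := exists_nonprojection nontriv.
  exists n; apply/asboolP; exists h => -[i E]; apply: hn; exists i.
  by rewrite E chom_proj.
case: (ex_minnP ex) => n /asboolP[h nh] nmin.
have trivlt m (k : C m) : m < n -> is_projection k.
  rewrite ltnNge => /negP mn; apply: contrapT => nk; apply: mn; apply: nmin.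
  by apply/asboolP; exists k.
case: n => [|[|n]] in h nh nmin trivlt *.
(* A unary [h] would give a binary nonprojection by adding a dummy variable. *)
- have nu : ~ is_projection (ccomp h (fun=> cproj (ord0 : 'I_2))).
    move=> [i E]; apply: nh; exists ord0.
    have := congr1 (fun k => ccomp k (fun=> cproj (ord0 : 'I_1))) E.
    rewrite ccompA !ccomp_proj => <-.
    rewrite -[LHS]ccomp_id; apply: comp_ext => j.
    by rewrite ord1.
  by case: nu.
- by case: nh.
pose val2 (b : 'I_n.+3 -> bool) x y := rho n.+2 h (fun l => if b l then x else y).
pose U (b : 'I_n.+3 -> bool) := forall x y, val2 b x y = x.
pose V (b : 'I_n.+3 -> bool) := forall x y, val2 b x y = y.
have UV b : U b \/ V b.
  have [i E] := triv1 (ccomp h (fun l => if b l then cproj ord0 else cproj ord_max)).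
  have E' x y : val2 b x y = two x y i.
    rewrite -[RHS](rep_proj rho) -E rep_comp /val2; congr (rho _ _ _).
    by apply/funext => l; case: (b l); rewrite rep_proj.
  case: (eqVneq i ord0) E' => [->|i0] E'; first by left=> x y; rewrite E'.
  by right=> x y; rewrite E' /two (negPf i0).
have VC b : V b -> U (fun l => ~~ b l).
  move=> Vb x y; rewrite -[RHS](Vb y x); congr (rho _ _ _).
  by apply/funext => l; case: (b l).
have idem x : rho n.+2 h (fun=> x) = x.
  have E b : val2 b x x = rho n.+2 h (fun=> x).
    by congr (rho _ _ _); apply/funext => l; case: (b l).
  by have [H|H] := UV (fun=> true); rewrite -(E (fun=> true)) H.
have [[b1 [b2 [U1 U2 dis]]]|nodis] :=
    pselect (exists b1 b2, [/\ U b1, U b2 & forall l, ~~ (b1 l && b2 l)]).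
  pose p : C 2 := ccomp h (fun l => if b1 l then cproj ord0
    else if b2 l then cproj ord_max else cproj (inord 1)).
  apply: (maltsev_weakly_abelian hC (p := p) nontriv wab) => x y.
    rewrite -[RHS](U1 x y) rep_comp /val2; congr (rho _ _ _); apply/funext => l.
    by case: (b1 l); [|case: (b2 l)]; rewrite rep_proj ?three1.
  rewrite -[RHS](U2 y x) rep_comp /val2; congr (rho _ _ _); apply/funext => l.
  move: (dis l); case: (b1 l); case: (b2 l) => // _; rewrite rep_proj ?three1 //.
have Uup (b1 b2 : pred _) : U b1 -> (forall l, b1 l -> b2 l) -> U b2.
  move=> U1 sub; have [//|/VC U2] := UV b2; case: nodis.
  exists b1, (fun l => ~~ b2 l); split=> // l.
  by case E: (b1 l) => //=; rewrite sub.
have [i Ui] : exists i, U (pred1 i).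
  apply: contrapT => nU.
  have V1 i : V (pred1 i) by have [H|//] := UV (pred1 i); case: nU; exists i.
  (* If no singleton is large, no initial segment is: the corner condition adds the point [k] to the
     segment below it. For the full set this contradicts idempotence. *)
  have Vlt k : k <= n.+3 -> V (fun l => l < k).
    elim: k => [_|k IH kn]; first by move=> x y; apply: idem.
    move=> x y; have Vk := IH (ltnW kn) x y.
    have {IH} V1k := V1 (Ordinal kn) x y.
    have := cc _ h (fun l => l < k) (fun i l => if i then x else y)
      (fun j l => if (val l == k) && j then x else y) y.
    move=> H; rewrite -[RHS]H.
    - congr (rho _ _ _); apply/funext => l; rewrite /mix andbT ltnS leq_eqVlt orbC.
      by case: (l < k).
    - rewrite -[RHS](idem y); congr (rho _ _ _); apply/funext => l.
      by rewrite /mix andbF; case: ifP.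
    - rewrite -[RHS]V1k; congr (rho _ _ _); apply/funext => l.
      rewrite /mix andbT /= -val_eqE /=; case: ltngtP => //.
    - rewrite -[RHS]Vk; congr (rho _ _ _); apply/funext => l.
      by rewrite /mix andbF.
  apply: ab0; rewrite -(Vlt _ (leqnn _) a0 b0) -[LHS](idem a0).
  by congr (rho _ _ _); apply/funext => l; rewrite ltn_ord.
(* Identifying the variables [i] and [p] lowers the arity and leaves a projection; since [{i, p}] is
   large, it is the one to the identified variable. *)
have semi p : p != i -> forall z : 'I_n.+3 -> A, z p = z i -> rho _ h z = z i.
  move=> pi.
  have [i' Ei'] : exists i', i = lift p i'.
    by case/unlift_some: pi => j E _; exists j.
  pose s l := if unlift p l is Some j then j else i'.
  have [j Ej] := trivlt _ (ccomp h (fun l => cproj (s l))) (ltnSn _).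
  have hE z : z p = z i -> rho _ h z = z (lift p j).
    move=> zpi; rewrite -[RHS](rep_proj rho j (fun l => z (lift p l))) -Ej rep_comp.
    congr (rho _ _ _); apply/funext => l; rewrite rep_proj /s.
    by case: unliftP => [k|] -> //; rewrite zpi Ei'.
  suff Eij : i = lift p j by move=> z zpi; rewrite (hE _ zpi) -Eij.
  have Uip : U (fun l => (l == i) || (l == p)) by apply: Uup Ui _ => l /= ->.
  have := hE (fun l => if (l == i) || (l == p) then a0 else b0).
  rewrite !eqxx orbT => /(_ erefl); rewrite [LHS]Uip.
  case: ifP => [|_ /ab0 //]; rewrite [_ == p]eq_sym (negPf (neq_lift p j)) orbF.
  by move/eqP.
case: (nonprojection hC nontriv nh (i := i)) => z.
have [p [q [pi qi pq]]] : exists p q, [/\ p != i, q != i & p != q].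
  exists (lift i ord0), (lift i ord_max).
  by split; rewrite ?(inj_eq lift_inj) // eq_sym neq_lift.
(* Row and column independently replace [z p] and [z q] by [z i]; unless both keep their values,
   [semi] gives [z i]. *)
have := cc _ h (pred1 p) (fun r l => if r then z l else z i)
  (fun c l => if (l == q) && ~~ c then z i else z l) (z i).
have ip : (i == p) = false by rewrite eq_sym (negPf pi).
have iq : (i == q) = false by rewrite eq_sym (negPf qi).
have qp : (q == p) = false by rewrite eq_sym (negPf pq).
move=> H; rewrite -[RHS]H.
- by congr (rho _ _ _); apply/funext => l; rewrite /mix andbF; case: ifP.
- by rewrite (semi p) // /mix /= ?eqxx ?ip ?iq.
- by rewrite (semi p) // /mix /= ?eqxx ?ip ?iq.
- by rewrite (semi q) // /mix /= ?eqxx ?ip ?iq ?qp.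
Qed.
End NoBinary.

(** * Idempotent clones and the kernels [{z | u z = u}] *)

Section Idempotent.
Variable C : clone.
Hypothesis idem : forall h : C 0, is_projection h.

Lemma idempotent_rep n (h : C n) (B : Type) (sigma : representation C B) x :
  sigma n h (fun=> x) = x.
Proof.
have [i E] := idem (ccomp h (fun=> cproj ord0)).
have := rep_comp sigma h (fun=> cproj ord0) (fun _ : 'I_1 => x).
rewrite E rep_proj => E'; rewrite [RHS]E'; congr (sigma n h _).
by apply/funext => l; rewrite rep_proj.
Qed.

Lemma binop_idem (f : C 1) (B : Type) (sigma : representation C B) x :
  binop f sigma x x = x.
Proof.
rewrite -[RHS](idempotent_rep f sigma x); congr (sigma 1 f _).
by apply/funext => l; rewrite /two; case: ifP.
Qed.

Lemma rep_binop (f : C 1) (B : Type) (sigma : representation C B) v :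
  sigma 1 f v = binop f sigma (v ord0) (v ord_max).
Proof. by rewrite {1}(two_eta v). Qed.

Definition opposite (f : C 1) : C 1 := ccomp f (two (cproj ord_max) (cproj ord0)).

Lemma binop_opposite (f : C 1) (B : Type) (sigma : representation C B) x y :
  binop (opposite f) sigma x y = binop f sigma y x.
Proof.
rewrite /binop rep_comp; congr (sigma 1 f _); apply/funext => l.
by rewrite /two; case: (l == ord0); rewrite rep_proj.
Qed.

Lemma binop_comp n (f : C 1) (g h : C n) (B : Type) (sigma : representation C B) z :
  sigma n (ccomp f (two g h)) z = binop f sigma (sigma n g z) (sigma n h z).
Proof.
by rewrite rep_comp; congr (sigma 1 f _); apply/funext => l; rewrite /two; case: ifP.
Qed.

Section Corner.
Variables (A : Type) (rho : representation C A).
Hypothesis cc : corner_condition rho.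

Lemma corner_binop (f : C 1) m1 m2 : corner_matrix rho m1 -> corner_matrix rho m2 ->
  corner_matrix rho (fun i j => binop f rho (m1 i j) (m2 i j)).
Proof. exact: corner_two. Qed.

(** The table of [f] on [u] and [x] is a matrix with three corners [u], and idempotence makes its
    last corner [x]. *)
Lemma no_zero (f : C 1) x u : binop f rho x u = u -> binop f rho u x = u -> x = u.
Proof.
move=> xu ux; rewrite -(binop_idem f rho x).
apply: (corner_conditionP (m := fun i j => binop f rho (if i then x else u) (if j then x else u)) cc) => //.
- apply: corner_binop; first exact: (corner_row _ (fun i => if i then x else u)).
  exact: (corner_col _ (fun j => if j then x else u)).
- exact: binop_idem.
Qed.

(** Two corner arguments: [u (z z) = u] first gives [u (z u) = u], which is then the third corner of
    the matrix ending at [u (z w)]. *)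
Lemma kernel_closed (g : C 1) u z w :
  binop g rho u z = u -> binop g rho u w = u -> binop g rho u (binop g rho z w) = u.
Proof.
move=> uz uw.
pose m z w i j := binop g rho u (binop g rho (if i then z else u) (if j then w else u)).
have M x y : corner_matrix rho (m x y).
  apply: corner_binop; first exact: (corner_row _ (fun=> u)).
  apply: corner_binop; first exact: (corner_row _ (fun i => if i then x else u)).
  exact: (corner_col _ (fun j => if j then y else u)).
have zu : m z w true false = u.
  apply: (corner_conditionP (m := fun i j => m z z i (~~ j)) cc).
  - apply: corner_binop; first exact: (corner_row _ (fun=> u)).
    apply: corner_binop; first exact: (corner_row _ (fun i => if i then z else u)).
    exact: (corner_col _ (fun j => if ~~ j then z else u)).
  - by rewrite /m /= uz binop_idem.
  - by rewrite /m /= !binop_idem.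
  - by rewrite /m /= binop_idem.
apply: (corner_conditionP (m := m z w) cc) => //.
  by rewrite /m /= !binop_idem.
by rewrite /m /= uw binop_idem.
Qed.

(** The variable [i] acts as a leftmost variable on [K t]. A single [i] has to serve all [t], which
    later couples two base points. *)
Lemma leftmost_subclone (T : Type) (K : T -> A -> Prop) (u : T -> A) :
  is_subclone (fun n (h : C n) => exists i, forall t v, (forall l, K t (v l)) ->
    K t (rho n h v) /\ (v i = u t -> rho n h v = u t)).
Proof.
split=> [n i|n m f g [i Hf] Hg].
  by exists i => t v Kv; rewrite rep_proj.
have [j Hj] := Hg i; exists j => t v Kv; rewrite rep_comp.
have [l|K1 K2] := Hf t (fun l => rho m (g l) v).
  by have [k Hk] := Hg l; have [] := Hk t v Kv.
split=> // E; apply: K2; have [_ H] := Hj t v Kv; exact: H.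
Qed.

End Corner.

(** * Rectangular bands *)

Section Rectangular.
Hypothesis hC : minimal_clone C.
Variables (A : Type) (rho : representation C A).
Hypothesis cc : corner_condition rho.
Variable f : C 1.
Hypothesis nf : ~ is_projection f.
Local Notation "x * y" := (binop f rho x y).

(* At a point [p] where [{z | p z = p}] is not reduced to [p], every term has a leftmost variable; at a point [q]
   where [{w | w q = q}] is not reduced to [q], every term has a rightmost one. A term for which both coincide is a
   projection, for otherwise it would generate [f]. *)
Lemma rectangular_weakly_abelian p z0 q w0 : p * z0 = p -> z0 <> p -> w0 * q = q -> w0 <> q ->
  forall (B : Type) (sigma : representation C B), weakly_abelian (rep_algebra sigma).
Proof.
move=> pz zp wq wneq.
pose pt (t : bool) := if t then p else q.
pose K (t : bool) x := if t then p * x = p else x * q = q.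
have Kcl t x y : K t x -> K t y -> K t (x * y).
  case: t => /=; first exact: kernel_closed.
  by rewrite -!(binop_opposite f) => xq yq; apply: kernel_closed.
have Kpt t : K t (pt t) by case: t => /=; rewrite binop_idem.
pose P t n (h : C n) i := forall v, (forall l, K t (v l)) ->
    K t (rho n h v) /\ (v i = pt t -> rho n h v = pt t).
have Pf t : P t 1 f (if t then ord0 else ord_max).
  move=> v Kv; rewrite rep_binop; split; first exact: Kcl.
  move=> vE; have := Kv (if t then ord_max else ord0).
  by move: vE; case: (t) => /= -> /=.
have Pall t n (h : C n) : exists i, P t n h i.
  have := minimal_generated hC (leftmost_subclone rho (fun _ : unit => K t) (fun=> pt t)) _ nf h.
  case; first by exists (if t then ord0 else ord_max) => _; apply: Pf.
  by move=> i Hi; exists i; apply: (Hi tt).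
have Pcomp t n (g h : C n) i : P t n (if t then g else h) i -> P t n (ccomp f (two g h)) i.
  move=> Pi v Kv; rewrite binop_comp.
  have [j /(_ v Kv)[Kg _]] := Pall t n g; have [k /(_ v Kv)[Kh _]] := Pall t n h.
  split; first exact: Kcl.
  move=> vE; have [_ /(_ vE)] := Pi v Kv.
  by move: Kg Kh; case: (t) => /= Kg Kh ->.
have Pproj t n (i : 'I_n.+1) : P t n (cproj i) i.
  by move=> v Kv; rewrite rep_proj.
have key n (h : C n) i : P true n h i -> P false n h i -> h = cproj i.
  move=> P1 P2.
  have [[k E]|nh] := pselect (is_projection h).
    rewrite E; congr cproj; apply: contrapT => /eqP ki.
    have [l|_] := P1 (fun l => if l == i then p else z0).
      by case: ifP => _ //; exact: (Kpt true).
    by rewrite eqxx E rep_proj (negPf ki) => /(_ erefl)/zp.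
  have [|i' Hi] := minimal_generated hC (leftmost_subclone rho K pt) _ nh f.
    by exists i => -[]; [apply: P1 | apply: P2].
  (* A controlling variable of [f] common to both points would give [q * w0 = q] or [z0 * p = p],
     which [no_zero] excludes. *)
  have [i0|i1] := eqVneq i' ord0.
    have [l|_] := Hi false (two q w0).
      by rewrite /two; case: ifP => _ //; exact: (Kpt false).
    rewrite i0 => /(_ erefl) qw; case: wneq.
    exact: no_zero wq qw.
  have [l|_] := Hi true (two z0 p).
    by rewrite /two; case: ifP => _ //; exact: (Kpt true).
  rewrite {1}/two (negPf i1) => /(_ erefl) zp'; case: zp.
  exact: no_zero zp' pz.
move=> B sigma; apply: corner_weakly_abelian.
pose mB x y := binop f sigma x y.
have rect x y z : mB (mB x y) (mB z x) = x.
  pose v := three x y z.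
  have E := key 2 (ccomp f (two (ccomp f (two (cproj ord0) (cproj (inord 1))))
    (ccomp f (two (cproj ord_max) (cproj ord0))))) ord0.
  have := congr1 (fun k => sigma 2 k v) (E _ _).
  rewrite !binop_comp !rep_proj /v three1; apply.
    by do 2![apply: (Pcomp)]; apply: Pproj.
  by do 2![apply: (Pcomp)]; apply: Pproj.
(* In [h * v i] the leftmost and rightmost variables coincide, and likewise in [v j * h]; both
   collapse by [key], and [rect] recovers [h]. *)
have form n (h : C n) i j v : P true n h i -> P false n h j ->
    sigma n h v = mB (v i) (v j).
  move=> Pi Pj.
  have E1 : mB (sigma n h v) (v i) = v i.
    have := congr1 (fun k => sigma n k v) (key n (ccomp f (two h (cproj i))) i _ _).
    rewrite binop_comp rep_proj; apply; apply: (Pcomp) => //; exact: Pproj.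
  have E2 : mB (v j) (sigma n h v) = v j.
    have := congr1 (fun k => sigma n k v) (key n (ccomp f (two (cproj j) h)) j _ _).
    rewrite binop_comp rep_proj; apply; apply: (Pcomp) => //; exact: Pproj.
  by rewrite -[v i]E1 -[v j]E2 rect.
have rect4 x y z t : mB (mB x y) (mB z t) = mB x t.
  pose v (l : 'I_4) := nth x [:: x; y; z; t] l.
  pose k : C 3 := ccomp f (two (ccomp f (two (cproj ord0) (cproj (inord 1))))
    (ccomp f (two (cproj (inord 2)) (cproj ord_max)))).
  have := form 3 k ord0 ord_max v.
  rewrite /k !binop_comp !rep_proj /v /= !inordK //=; apply.
    by do 2![apply: (Pcomp)]; apply: Pproj.
  by do 2![apply: (Pcomp)]; apply: Pproj.
move=> n h b r c u.
have [i Pi] := Pall true n h; have [j Pj] := Pall false n h.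
rewrite !(form n h i j) // /mix; case: (b i); case: (b j) => // e0 e1 e2.
  by rewrite -(rect4 _ (c false j) (r false i)) e1 e2 /mB binop_idem.
by rewrite -(rect4 _ (r false j) (c false i)) e1 e2 /mB binop_idem.
Qed.
End Rectangular.
End Idempotent.

(** * Powers of left and right multiplications *)

Section Powers.
Variable C : clone.
Variable f : C 1.

Definition rpow (B : Type) (sigma : representation C B) k y x :=
  iter k (fun w => binop f sigma w y) x.
Definition lpow (B : Type) (sigma : representation C B) k x y :=
  iter k (binop f sigma x) y.

Lemma uniform_rpow n F G k : @uniform C n F -> @uniform C n G ->
  uniform (fun A rho z => rpow rho k (G A rho z) (F A rho z)).
Proof. by move=> uF uG; elim: k => [|k IH] //=; apply: uniform_binop. Qed.

Lemma uniform_lpow n F G k : @uniform C n F -> @uniform C n G ->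
  uniform (fun A rho z => lpow rho k (G A rho z) (F A rho z)).
Proof. by move=> uF uG; elim: k => [|k IH] //=; apply: uniform_binop. Qed.

End Powers.

(** * The case [x (x y) = x] *)

Section PCyclic.
Variable C : clone.
Hypothesis idem : forall h : C 0, is_projection h.
Hypothesis hC : minimal_clone C.
Variables (A : Type) (rho : representation C A).
Hypothesis nontriv : ~ trivial_algebra (rep_algebra rho).
Hypothesis cc : corner_condition rho.
Variable f : C 1.
Hypothesis nf : ~ is_projection f.
Local Notation "x * y" := (binop f rho x y).
Hypothesis xxy : forall x y, x * (x * y) = x.

(** The matrix row headed by [p = v * y] is constantly [p] by [xxy], and the other row starts with
    [v * (y * y) = p]. *)
Lemma mul_right_mul v y z : v * (y * z) = v * y.
Proof.
pose p := v * y.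
apply: (corner_conditionP (m := fun i j : bool => (if i then v else p) *
  ((if i then y else p) * (if j then z else y))) cc) => //=; rewrite ?xxy ?(binop_idem idem) //.
apply: corner_binop; first exact: (corner_row _ (fun i : bool => if i then v else p)).
apply: corner_binop; first exact: (corner_row _ (fun i : bool => if i then y else p)).
exact: (corner_col _ (fun j : bool => if j then z else y)).
Qed.

Lemma mul_right_rpow v x y k : v * rpow f rho k y x = v * x.
Proof. by elim: k => //= k IH; rewrite mul_right_mul. Qed.

Lemma rpow_mul x y k : rpow f rho k y x * x = rpow f rho k y x.
Proof. by rewrite -(mul_right_rpow _ x y k) (binop_idem idem). Qed.

Lemma rpow_fix k x y : x * y = x -> rpow f rho k y x = x.
Proof. by move=> E; elim: k => //= k ->. Qed.


Lemma not_left_zero : ~ forall x y, x * y = x.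
Proof.
move=> H; apply: (nonprojection hC nontriv nf (i := ord0)) => z.
by rewrite rep_binop H.
Qed.

(** Unless [(x y) y] is a projection it generates [f], while its binary terms are only [x y^(2j)]
    and [y x^(2j)]. Hence [x y = x y^(2j)] with [j > 0], the other options making [f] a left zero
    operation; a corner argument cancels one factor [y]. *)
Lemma rpow_order : exists m, forall x y, rpow f rho m.+1 y x = x.
Proof.
pose f2 : C 1 := ccomp f (two f (cproj ord_max)).
have f2E v : rho 1 f2 v = v ord0 * v ord_max * v ord_max.
  by rewrite /f2 binop_comp rep_proj rep_binop.
have [[i E]|nf2] := pselect (is_projection f2).
  have {}E x y : x * y * y = two x y i by rewrite -[RHS](rep_proj rho) -E f2E.
  have [i0|i0] := eqVneq i ord0; first by exists 1 => x y; rewrite /= E i0.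
  case: not_left_zero => c a.
  have H b : c * a = c * b.
    by rewrite -(mul_right_mul c a b) -(mul_right_mul _ (a * b) b) E /two (negPf i0).
  by rewrite (H c) (binop_idem idem).
pose good (phi : A -> A -> A) := exists j, (forall x y, phi x y = rpow f rho j.*2 y x) \/
  (forall x y, phi x y = rpow f rho j.*2 x y).
have [|P goodP||j [H|H]] := @minimal_generated C hC (fun n (h : C n) =>
  forall P : 'I_n.+1 -> A -> A -> A, (forall l, good (P l)) ->
  good (fun x y => rho n h (fun l => P l x y))) 1 f2 _ _ nf2 1 f (two (fun x _ => x) (fun _ y => y)).
- split=> [n i P goodP|n m h k Sh Sk P goodP].
    by have [j H] := goodP i; exists j; case: H => H; [left|right] => x y; rewrite rep_proj.
  have [j H] := Sh (fun l x y => rho m (k l) (fun s => P s x y)) (fun l => Sk l P goodP).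
  by exists j; case: H => H; [left|right] => x y; rewrite rep_comp.
- have [j Hj] := goodP ord0; have [k Hk] := goodP ord_max.
  case: Hj Hk => Hj [] Hk.
  + exists j; left=> x y; rewrite f2E Hj Hk.
    by rewrite !mul_right_rpow !rpow_mul.
  + exists j.+1; left=> x y; rewrite f2E Hj Hk.
    by rewrite !mul_right_rpow doubleS.
  + exists j.+1; right=> x y; rewrite f2E Hj Hk.
    by rewrite !mul_right_rpow doubleS.
  + exists j; right=> x y; rewrite f2E Hj Hk.
    by rewrite !mul_right_rpow !rpow_mul.
- move=> l; rewrite /two; case: ifP => _; exists 0; [by left | by right].
- have {}H x y : x * y = rpow f rho j.*2 y x.
    by rewrite -H rep_binop.
  case: j H => [|j] H; first by case: not_left_zero.
  rewrite doubleS in H; exists j.*2 => x y.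
  (* As [e = x y^(2j+1)] is fixed by [y^(2j+1)], the corner condition gives [x e^(2j+1) = e],
     whereas [x e = x]. *)
  set e := rpow _ _ _ _ _.
  have ee : rpow f rho j.*2.+1 y e = e.
    by rewrite [LHS]iterSr -[e * y]/(rpow f rho j.*2.+2 y x) -H -[LHS]iterSr.
  have : rpow f rho j.*2.+1 e x = e.
    apply: (corner_conditionP (m := fun i k : bool => rpow f rho j.*2.+1
      (if k then e else y) (if i then x else e)) cc).
    - rewrite /rpow; elim: (j.*2.+1) => [|k IH] /=.
        exact: (corner_row _ (fun i : bool => if i then x else e)).
      by apply: corner_binop => //; apply: (corner_col _ (fun k : bool => if k then e else y)).
    - exact: ee.
    - by rewrite rpow_fix ?(binop_idem idem).
    - by [].
  by rewrite rpow_fix // mul_right_rpow (binop_idem idem).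
case: not_left_zero => x y.
have {}H : x * y = rpow f rho j.*2 x y.
  by rewrite -H rep_binop.
by rewrite -(mul_right_rpow x y x j.*2) -H xxy.
Qed.

(* Right multiplications become commuting permutations with [R_(y z) = R_y]. *)
Lemma pcyclic_weakly_abelian (B : Type) (sigma : representation C B) :
  weakly_abelian (rep_algebra sigma).
Proof.
have [m mE] := rpow_order.
pose mB x y := binop f sigma x y.
have lift n (F : forall D : Type, representation C D -> ('I_n.+1 -> D) -> D) i :
    uniform F -> (forall z, F A rho z = z i) -> forall z, F B sigma z = z i.
  by move=> uF FA; exact: (uniform_absorption hC uF nontriv FA).
have pB x y : rpow f sigma m.+1 y x = x.
  apply: (lift 1 (fun D tau z => rpow f tau m.+1 (z ord_max) (z ord0)) ord0 _ _ (two x y)) => //.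
  by apply: uniform_rpow; apply: uniform_var.
(* The [m]-th power of a right multiplication inverts it, so an equation with value [mB x y] becomes
   an absorption identity and can be brought over from [A]. *)
have back x y w : rpow f sigma m y w = x -> w = mB x y.
  by move=> E; rewrite -[LHS](pB w y) /= -E.
have rB x y z : mB x (mB y z) = mB x y.
  apply: back.
  have := lift 2 (fun D tau z => rpow f tau m (z (inord 1))
    (binop f tau (z ord0) (binop f tau (z (inord 1)) (z ord_max)))) ord0.
  move=> /(_ _ _ (three x y z)); rewrite three1; apply.
    apply: uniform_rpow; last exact: uniform_var.
    by do 2![apply: uniform_binop; first exact: uniform_var]; apply: uniform_var.
  by move=> v; rewrite mul_right_mul -[LHS]iterSr; apply: mE.
have cB x y z : mB (mB x y) z = mB (mB x z) y.
  apply/back/back.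
  have := lift 2 (fun D tau z => rpow f tau m (z ord_max) (rpow f tau m (z (inord 1))
    (binop f tau (binop f tau (z ord0) (z (inord 1))) (z ord_max)))) ord0.
  move=> /(_ _ _ (three x y z)); rewrite three1; apply.
    apply: uniform_rpow; last exact: uniform_var.
    apply: uniform_rpow; last exact: uniform_var.
    by do 2![apply: uniform_binop; last exact: uniform_var]; apply: uniform_var.
  move=> v; set x0 := v ord0; set y0 := v (inord 1); set z0 := v ord_max.
  apply: (corner_conditionP (m := fun i j : bool => rpow f rho m (if j then z0 else x0)
    (rpow f rho m (if i then y0 else x0)
      (x0 * (if i then y0 else x0) * (if j then z0 else x0)))) cc) => /=.
  - have Mr : corner_matrix rho (fun i _ : bool => if i then y0 else x0).
      exact: (corner_row _ (fun i : bool => if i then y0 else x0)).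
    have Mc : corner_matrix rho (fun _ j : bool => if j then z0 else x0).
      exact: (corner_col _ (fun j : bool => if j then z0 else x0)).
    have Mp k m1 m2 : corner_matrix rho m1 -> corner_matrix rho m2 ->
        corner_matrix rho (fun i j => rpow f rho k (m1 i j) (m2 i j)).
      by move=> M1 M2; rewrite /rpow; elim: k => //= k IH; apply: corner_binop.
    apply: (Mp) => //; apply: (Mp) => //; apply: corner_binop => //; apply: corner_binop => //.
    exact: (corner_row _ (fun=> x0)).
  - by rewrite !(binop_idem idem) !rpow_fix ?(binop_idem idem).
  - rewrite (binop_idem idem) (rpow_fix m (x := x0 * z0)) ?(rpow_mul x0 z0 1) //.
    by rewrite -[LHS]iterSr; apply: mE.
  - have E : rpow f rho m y0 (x0 * y0 * x0) = x0.
      by rewrite (rpow_mul x0 y0 1) -[LHS]iterSr; apply: mE.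
    by rewrite E rpow_fix ?(binop_idem idem).
pose R n (v : 'I_n.+1 -> B) := foldl (fun w l => mB w (v l)).
have mR n (v : 'I_n.+1 -> B) x i s : mB x (R n v (v i) s) = mB x (v i).
  by elim/last_ind: s => // s l IH; rewrite /R foldl_rcons rB.
(* Normal form: a variable followed by right multiplications by variables; [rB] reduces any right
   factor to its first variable. *)
have form n (h : C n) : exists i s, forall v, sigma n h v = R n v (v i) s.
  apply: (@minimal_generated C hC (fun n (h : C n) => exists i s, forall v,
    sigma n h v = R n v (v i) s) 1 f _ _ nf n h).
    split=> [k i|k l g h' [i [s E]] Hg]; first by exists i, [::] => v; rewrite rep_proj.
    have /choice[gi /choice[gs gE]] : forall l, exists i, exists s, forall v,
        sigma _ (h' l) v = R _ v (v i) s by move=> t; have [a [b H]] := Hg t; exists a, b.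
    exists (gi i), (gs i ++ map gi s) => v.
    have -> : R l v (v (gi i)) (gs i ++ map gi s) =
        R l v (R l v (v (gi i)) (gs i)) (map gi s) by rewrite /R foldl_cat.
    rewrite rep_comp E gE; move: (R l v (v (gi i)) (gs i)) => w.
    elim: s w {E} => //= t s IH w.
    by rewrite gE mR; apply: IH.
  by exists ord0, [:: ord_max] => v /=; rewrite rep_binop.
have Rmul n (v : 'I_n.+1 -> B) x y s : R n v (mB x y) s = mB (R n v x s) y.
  by elim: s x => //= l s IH x; rewrite cB IH.
have Rinj n (v : 'I_n.+1 -> B) s : injective (R n v ^~ s).
  elim/last_ind: s => // s l IH x y; rewrite /R !foldl_rcons => E; apply: IH.
  by rewrite -[LHS](pB _ (v l)) -[RHS](pB _ (v l)) [LHS]iterSr [RHS]iterSr; congr iter.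
have Rsplit n (v : 'I_n.+1 -> B) (b : pred 'I_n.+1) x s :
    R n v x s = R n v (R n v x [seq l <- s | b l]) [seq l <- s | ~~ b l].
  elim: s x => //= l s IH x; rewrite IH; case: (b l) => //=.
  by rewrite Rmul.
have Rmix n (b : pred 'I_n.+1) (r c : 'I_n.+1 -> B) x s : R n (mix b r c) x s =
    R n c (R n r x [seq l <- s | b l]) [seq l <- s | ~~ b l].
  rewrite (Rsplit _ _ b); set w := R n r x _.
  have -> : R n (mix b r c) x [seq l <- s | b l] = w.
    rewrite {}/w; elim: s x => //= l s IH x; case bl: (b l) => /=; rewrite IH //.
    by rewrite /mix bl.
  elim: s w => //= l s IH w; case bl: (b l) => /=; rewrite IH //.
  by rewrite /mix bl.
have Rcomm n (v v' : 'I_n.+1 -> B) x s s' : R n v (R n v' x s) s' = R n v' (R n v x s') s.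
  by elim: s' x => //= l s' IH x; rewrite -IH (Rmul _ v').
(* With row and column multiplications separated, injectivity cancels one kind, and the known
   corners give the fourth. *)
apply: corner_weakly_abelian => n h b r c u; have [i [s E]] := form n h.
rewrite !E !Rmix /mix; case: (b i) => E0 E1 E2.
  rewrite -E1; congr (R _ _ _ _).
  by apply: (Rinj n (c false) [seq l <- s | ~~ b l]); rewrite E2.
rewrite !(Rcomm _ (c _)) in E0 E1 E2 *.
rewrite -E2; congr (R _ _ _ _).
by apply: (Rinj n (r false) [seq l <- s | b l]); rewrite E1.
Qed.
End PCyclic.

(** * The case where [z u = u] forces [z = u] *)

Section Cancellative.
Variable C : clone.
Hypothesis idem : forall h : C 0, is_projection h.
Hypothesis hC : minimal_clone C.
Variables (A : Type) (rho : representation C A).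
Hypothesis nontriv : ~ trivial_algebra (rep_algebra rho).
Hypothesis cc : corner_condition rho.
Variable f : C 1.
Hypothesis nf : ~ is_projection f.
Local Notation "x * y" := (binop f rho x y).
Hypothesis cancel : forall z u, z * u = u -> z = u.
Hypothesis no_xxy : forall g : C 1, ~ is_projection g ->
  ~ forall x y, binop g rho x (binop g rho x y) = x.

Local Notation idemA := (binop_idem idem).

(** By minimality [f] inherits from [g] a controlling variable on the kernel of [g] at [u]. The left
    one gives the claim; the right one gives [z * u = u], so [z = u]. *)
Lemma kernel_sub (g : C 1) u z : ~ is_projection g ->
  binop g rho u z = u -> u * z = u.
Proof.
move=> ng uz.
pose K (t : unit) x := binop g rho u x = u.
have [|i Hi] := minimal_generated hC (leftmost_subclone rho K (fun=> u)) _ ng f.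
  exists ord0 => t v Kv; rewrite rep_binop; split.
    by apply: (kernel_closed idem cc); apply: Kv.
  by move=> ->; apply: (Kv ord_max).
have Ku : K tt u by rewrite /K idemA.
have [i0|i0] := eqVneq i ord0.
  have [l|_] := Hi tt (two u z); first by rewrite /two; case: ifP.
  by rewrite i0; apply.
have [l|_] := Hi tt (two z u); first by rewrite /two; case: ifP.
rewrite {1}/two (negPf i0) => /(_ erefl)/cancel ->; exact: idemA.
Qed.

Lemma is_projection_binop (g : C 1) : is_projection g ->
  (forall x y, binop g rho x y = x) \/ (forall x y, binop g rho x y = y).
Proof.
move=> [i ->]; have [->|i0] := eqVneq i ord0; [left|right] => x y.
  by rewrite /binop rep_proj.
by rewrite /binop rep_proj /two (negPf i0).
Qed.

(* With [a = s_00 = s_01], [b = s_10], [r_0 = b] and [r_1 = a], the matrix with entries [(a s_ij) (r_i b)] has value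
   [a b] at the three corners other than (1, 1). *)
Lemma switch (s : bool -> bool -> A) : corner_matrix rho s ->
  s false true = s false false ->
  s false false * s true true = s false false * s true false.
Proof.
move=> Ms E; set a := s false false; set b := s true false.
apply: cancel.
apply: (corner_conditionP (m := fun i j => (a * s i j) *
   ((if i then a else b) * b)) cc).
- apply: corner_binop; apply: corner_binop => //; first exact: (corner_row _ (fun=> a)).
    exact: (corner_row _ (fun i : bool => if i then a else b)).
  exact: (corner_row _ (fun=> b)).
- by rewrite -/a !idemA.
- by rewrite E -/a !idemA.
- by rewrite -/b idemA.
Qed.

(** [switch] for a matrix whose first row is constantly [b * c] and whose second row holds the two
    sides of the entropic law. *)
Lemma switch_entropic a b c d :
  (b * c) * ((a * b) * (c * d)) = (b * c) * ((a * c) * (b * d)).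
Proof.
have := @switch (fun i j => ((if i then a else b) * (if j then c else b)) *
  ((if j then b else c) * (if i then d else c))).
rewrite /= !idemA => -> //.
apply: corner_binop; apply: corner_binop.
- exact: (corner_row _ (fun i : bool => if i then a else b)).
- exact: (corner_col _ (fun j : bool => if j then c else b)).
- exact: (corner_col _ (fun j : bool => if j then b else c)).
- exact: (corner_row _ (fun i : bool => if i then d else c)).
Qed.

(** With this law, [switch_entropic] and cancellation give [(x y) x = x y], hence [x (x y) = x]. *)
Lemma not_xyx : ~ forall x y, x * (y * x) = x.
Proof.
move=> H.
have xyx x y : (x * y) * x = x * y.
  set u := x * y; apply/esym/cancel.
  by have := switch_entropic x x y x; rewrite !idemA H -/u => <-.
apply: (no_xxy nf) => x y.
by rewrite -(xyx x y) H.
Qed.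

Local Notation ctxA := (ctx (fun x y => x * y)).

Lemma ctx_matrix (s t : seq (bool * A)) (e : bool -> A) : unzip1 s = unzip1 t ->
  corner_matrix rho (fun i j => ctxA (if i then t else s) (e j)).
Proof.
elim: s t => [|[b v] s IH] [|[b' w] t] //= => [_|[<- /IH M]].
  have -> : (fun i j : bool => ctxA (if i then [::] else [::]) (e j)) = fun _ j => e j.
    by apply/funext => i; apply/funext => j; case: i.
  exact: corner_col.
have Mv : corner_matrix rho (fun i _ : bool => if i then w else v).
  exact: (corner_row _ (fun i : bool => if i then w else v)).
have := if b as b0 return corner_matrix rho (fun i j => if b0
    then (if i then w else v) * ctxA (if i then t else s) (e j)
    else ctxA (if i then t else s) (e j) * (if i then w else v))
  then corner_binop f Mv M else corner_binop f M Mv.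
by congr corner_matrix; apply/funext => i; apply/funext => j; case: i.
Qed.

Lemma switch_ctx (s t : seq (bool * A)) p q : unzip1 s = unzip1 t ->
  ctxA s q = ctxA s p -> ctxA s p * ctxA t q = ctxA s p * ctxA t p.
Proof.
by move=> /(ctx_matrix (fun j : bool => if j then q else p))/switch.
Qed.

(** The translations are peeled off from the outside. [x (x y)] and [x (y x)] are not the first
    projection, by [no_xxy] and [not_xyx], so [kernel_sub] removes a layer; if one is the second
    projection, the claim is immediate. *)
Lemma kernel_ctx s u z : ctxA [seq (b, u) | b <- s] z = u -> u * z = u.
Proof.
have proj_or g x y : binop g rho x y = x -> (is_projection g ->
    (forall x y, binop g rho x y = x) -> False) -> x * y = x.
  move=> E H; have [pg|ng] := pselect (is_projection g); last exact: kernel_sub E.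
  have [/(H pg)//|g2] := is_projection_binop pg.
  have yx : y = x by rewrite -[LHS](g2 x y).
  by rewrite yx idemA.
have inner : forall s, u * ctxA [seq (b, u) | b <- s] z = u -> u * z = u.
  elim=> //= -[] s' IH /= E; apply: IH.
    apply: (proj_or (ccomp f (two (cproj ord0) f))).
      by rewrite /binop binop_comp rep_proj rep_binop /=.
    move=> pg H; apply: (no_xxy nf) => x y; rewrite -[RHS](H x y).
    by rewrite [in RHS]/binop binop_comp rep_proj [in RHS]rep_binop.
  apply: (proj_or (ccomp f (two (cproj ord0) (opposite f)))).
    by rewrite /binop binop_comp rep_proj -/(binop _ _ _ _) binop_opposite.
  move=> pg H; apply: not_xyx => x y; rewrite -[RHS](H x y).
  by rewrite [in RHS]/binop binop_comp rep_proj -[rho 1 (opposite f) _]/(binop _ _ _ _) binop_opposite.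
elim: s => [/= ->|[] s' IH /= E]; first exact: idemA.
  exact: inner E.
exact/IH/cancel.
Qed.

Local Notation not_left_zero := (not_left_zero hC nontriv nf).

(** * The entropic quotient of the free algebra on two generators *)

Local Notation M := (C 1).
Definition cmul (p q : M) : M := ccomp f (two p q).
Definition rep_eq (p q : M) := rho 1 p = rho 1 q.
Local Notation ctxM := (ctx cmul).
Definition left_ctx (vs : seq M) := ctxM [seq (true, v) | v <- vs].
(* Weak abelianness yields the entropic law only inside a left context, see [switch_entropic]; the quotient by [ctx_eq]
   is an entropic groupoid. *)
Definition ctx_eq (p q : M) := exists vs, rep_eq (left_ctx vs p) (left_ctx vs q).

Lemma rep_cmul p q v : rho 1 (cmul p q) v = rho 1 p v * rho 1 q v.
Proof. exact: binop_comp. Qed.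

Lemma rep_ctx s p v :
  rho 1 (ctxM s p) v = ctxA [seq (bv.1, rho 1 bv.2 v) | bv <- s] (rho 1 p v).
Proof. by elim: s => //= -[[] w] s IH /=; rewrite rep_cmul IH. Qed.

Lemma rep_eq_cmul p p' q q' : rep_eq p p' -> rep_eq q q' -> rep_eq (cmul p q) (cmul p' q').
Proof. by move=> E E'; apply/funext => v; rewrite !rep_cmul E E'. Qed.

Lemma rep_eq_ctx s p q : rep_eq p q -> rep_eq (ctxM s p) (ctxM s q).
Proof. by move=> E; apply/funext => v; rewrite !rep_ctx E. Qed.

Lemma rep_eq_idem p : rep_eq (cmul p p) p.
Proof. by apply/funext => v; rewrite rep_cmul idemA. Qed.

Lemma left_ctx_cat vs ws p : left_ctx (vs ++ ws) p = left_ctx vs (left_ctx ws p).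
Proof. by rewrite /left_ctx map_cat ctx_cat. Qed.

(** Exchanges a context for any other of the same length at the price of one outer factor, so that
    two witnesses of [ctx_eq] can be merged. *)
Lemma left_ctx_switch vs ws p q : size vs = size ws ->
  rep_eq (left_ctx vs p) (left_ctx vs q) ->
  rep_eq (left_ctx (left_ctx vs p :: ws) p) (left_ctx (left_ctx vs p :: ws) q).
Proof.
move=> sz E; apply/funext => v; rewrite /left_ctx /= !rep_cmul.
have Ev := congr1 (@^~ v) E; rewrite /left_ctx /= in Ev.
rewrite !rep_ctx in Ev *; apply/esym/switch_ctx => //.
rewrite /unzip1 -!map_comp.
have H (us : seq M) :
    [seq (fst \o ((fun bv : bool * M => (bv.1, rho 1 bv.2 v)) \o pair true)) i | i <- us] =
    nseq (size us) true.
  by elim: us => //= ? ? ->.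
by rewrite !H sz.
Qed.

Lemma rep_eq_ctx_eq p q : rep_eq p q -> ctx_eq p q.
Proof. by exists [::]. Qed.

Lemma ctx_eq_refl p : ctx_eq p p. Proof. by exists [::]. Qed.
Lemma ctx_eq_sym p q : ctx_eq p q -> ctx_eq q p.
Proof. by case=> vs E; exists vs. Qed.

(** Witnesses are padded to equal length and merged by [left_ctx_switch]. The default [p] of [nth]
    makes indices out of range harmless. *)
Lemma ctx_eq_common p (qs : seq M) : (forall l, ctx_eq p (nth p qs l)) ->
  exists vs, forall l, rep_eq (left_ctx vs p) (left_ctx vs (nth p qs l)).
Proof.
elim: qs => [_|q qs IH H]; first by exists [::] => l; rewrite nth_nil.
have [vs Evs] : exists vs, forall l, rep_eq (left_ctx vs p) (left_ctx vs (nth p qs l)).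
  by apply: IH => l; apply: (H l.+1).
have [ws Ews] := H 0.
have pad us n r s : rep_eq (left_ctx us r) (left_ctx us s) ->
    rep_eq (left_ctx (nseq n p ++ us) r) (left_ctx (nseq n p ++ us) s).
  by rewrite !left_ctx_cat; apply: rep_eq_ctx.
pose vs1 := nseq (size ws) p ++ vs; pose ws1 := nseq (size vs) p ++ ws.
have sz : size vs1 = size ws1 by rewrite !size_cat !size_nseq addnC.
exists (left_ctx vs1 p :: ws1) => -[|l] /=.
  by apply: (@rep_eq_cmul _ _ _ _ erefl); apply: pad.
by apply: left_ctx_switch => //; apply: pad.
Qed.

Lemma ctx_eq_trans p q r : ctx_eq p q -> ctx_eq q r -> ctx_eq p r.
Proof.
move=> pq qr; have [|vs E] := @ctx_eq_common q [:: p; r].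
  by case=> [|[|l]] /=; [exact: ctx_eq_sym | | rewrite nth_nil; exact: ctx_eq_refl].
exists vs; have := E 1; have := E 0 => /= E0 E1.
by rewrite /rep_eq -E1 -E0.
Qed.

Lemma ctx_eq_cancel z p q : ctx_eq (cmul z p) (cmul z q) -> ctx_eq p q.
Proof. by case=> vs; exists (vs ++ [:: z]); rewrite !left_ctx_cat. Qed.

(** The context is exchanged for one of the same length whose innermost factor is [z]. *)
Lemma ctx_eq_cmull z p q : ctx_eq p q -> ctx_eq (cmul z p) (cmul z q).
Proof.
case=> vs E; exists (left_ctx (z :: vs) p :: nseq (size vs) z).
have E1 : rep_eq (left_ctx (z :: vs) p) (left_ctx (z :: vs) q).
  exact: (@rep_eq_cmul _ _ _ _ erefl).
have := left_ctx_switch (ws := nseq (size vs) z ++ [:: z]) _ E1.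
rewrite -!cat_cons !left_ctx_cat; apply.
by rewrite size_cat size_nseq addn1.
Qed.

Lemma ctx_eq_entropic a b c d :
  ctx_eq (cmul (cmul a b) (cmul c d)) (cmul (cmul a c) (cmul b d)).
Proof.
exists [:: cmul b c]; apply/funext => v.
by rewrite /left_ctx /= !rep_cmul switch_entropic.
Qed.

Lemma ctx_eq_distr z p q : ctx_eq (cmul z (cmul p q)) (cmul (cmul z p) (cmul z q)).
Proof.
apply: ctx_eq_trans (ctx_eq_entropic z z p q).
by apply: rep_eq_ctx_eq; apply: rep_eq_cmul => //; apply/esym/rep_eq_idem.
Qed.

(** Left contexts are endomorphisms modulo [ctx_eq] and can be cancelled, so it suffices to compare
    inside a context equating [p] and [q]. *)
Lemma ctx_eq_cmulr z p q : ctx_eq p q -> ctx_eq (cmul p z) (cmul q z).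
Proof.
case=> vs E.
have D us r s : ctx_eq (left_ctx us (cmul r s)) (cmul (left_ctx us r) (left_ctx us s)).
  elim: us => [|u us IH] /=; first exact: ctx_eq_refl.
  exact: ctx_eq_trans (ctx_eq_cmull u IH) (ctx_eq_distr _ _ _).
have C1 us r s : ctx_eq (left_ctx us r) (left_ctx us s) -> ctx_eq r s.
  by elim: us => //= u us IH /ctx_eq_cancel.
apply: (C1 vs); apply: ctx_eq_trans (D vs p z) _.
apply: ctx_eq_trans (ctx_eq_sym (D vs q z)).
by apply: rep_eq_ctx_eq; apply: rep_eq_cmul.
Qed.

Lemma ctx_eq_cmul p p' q q' : ctx_eq p p' -> ctx_eq q q' -> ctx_eq (cmul p q) (cmul p' q').
Proof.
by move=> E E'; apply: ctx_eq_trans (ctx_eq_cmulr _ E) (ctx_eq_cmull _ E').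
Qed.

Lemma ctx_eq_ctxM s p q : ctx_eq (ctxM s (cmul p q)) (cmul (ctxM s p) (ctxM s q)).
Proof.
elim: s => [|[b v] s IH] /=; first exact: ctx_eq_refl.
case: b.
  exact: ctx_eq_trans (ctx_eq_cmull _ IH) (ctx_eq_distr _ _ _).
apply: ctx_eq_trans (ctx_eq_cmulr _ IH) _.
apply: ctx_eq_trans (ctx_eq_entropic _ _ _ _).
by apply: ctx_eq_cmull; apply: rep_eq_ctx_eq; apply/esym/rep_eq_idem.
Qed.

Local Notation x := (cproj (ord0 : 'I_2) : M).
Local Notation y := (cproj (ord_max : 'I_2) : M).

Definition pi1 := quot_pi ctx_eq.

Lemma pi1P p q : pi1 p = pi1 q <-> ctx_eq p q.
Proof. exact: (quot_piP ctx_eq_refl ctx_eq_sym ctx_eq_trans). Qed.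

Lemma affine_quotient :
  exists (G : zmodType) (phi : {additive G -> G}) (iota : M -> G),
  [/\ iota x = 0%R /\ (forall p q, rep_eq p q -> iota p = iota q),
      forall p q, iota (cmul p q) = (iota p - phi (iota p) + phi (iota q))%R,
      forall g, phi g = 0%R -> g = 0%R,
      forall g, phi g = g -> g = 0%R
    & forall p, iota p = 0%R -> exists s, ctx_eq (ctxM s p) (ctxM s x)].
Proof.
pose mul1 (a b : quot ctx_eq) := pi1 (cmul (quot_repr a) (quot_repr b)).
have mul1E p q : mul1 (pi1 p) (pi1 q) = pi1 (cmul p q).
  apply/pi1P/ctx_eq_cmul; apply/pi1P; exact: quot_reprK.
have ind1 (P : quot ctx_eq -> Prop) : (forall p, P (pi1 p)) -> forall a, P a.
  by move=> H a; rewrite -(quot_reprK a); apply: H.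
have mulI a : mul1 a a = a.
  by elim/ind1: a => p; rewrite mul1E; apply/pi1P/rep_eq_ctx_eq/rep_eq_idem.
have mulACA a b c d : mul1 (mul1 a b) (mul1 c d) = mul1 (mul1 a c) (mul1 b d).
  elim/ind1: a => a; elim/ind1: b => b; elim/ind1: c => c; elim/ind1: d => d.
  by rewrite !mul1E; apply/pi1P/ctx_eq_entropic.
have [G [phi [iota [i0 iM inj1 inj2 ker]]]] := affine_group (pi1 x) mulI mulACA.
exists G, phi, (iota \o pi1); split=> //=.
- by split=> // p q /rep_eq_ctx_eq/pi1P ->.
- by move=> p q; rewrite -mul1E iM.
move=> p /ker[s E]; exists [seq (bv.1, quot_repr bv.2) | bv <- s].
apply/pi1P.
have H r : pi1 (ctxM [seq (bv.1, quot_repr bv.2) | bv <- s] r) = ctx mul1 s (pi1 r).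
  elim: s {E} => //= -[b v] s IH /=; rewrite -IH -[v in RHS](quot_reprK v).
  by case: b; rewrite mul1E.
by rewrite !H.
Qed.

Lemma ctx_const s u : ctxA [seq (b, u) | b <- s] u = u.
Proof. by elim: s => //= -[] s ->; apply: idemA. Qed.

(** The corner condition replaces every factor of the context by [u], and then [kernel_ctx]
    applies. *)
Lemma ctx_absorb s u z : ctxA s u = u -> ctxA s z = u -> u * z = u.
Proof.
move=> Eu Ez; apply: (@kernel_ctx (unzip1 s)).
have E : unzip1 s = unzip1 [seq (b, u) | b <- unzip1 s].
  by rewrite /unzip1 -!map_comp; apply: eq_map.
apply: (corner_conditionP cc (ctx_matrix (fun j : bool => if j then z else u) E)) => //=.
exact: ctx_const.
Qed.

(* If some context identified [x] and [y], then, contexts being endomorphisms, a context would take a single value [g]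
   at [x], [y], [x y] and [y x]; expressing [x y] through [g] then yields a context with value [x y] at [x y] and at
   [y], hence [(x y) y = x y]. *)
Lemma ctx_separates s : ~ ctx_eq (ctxM s y) (ctxM s x).
Proof.
move=> E; pose xs := ctxM s x.
have Exx e e' : ctx_eq (ctxM s e) xs -> ctx_eq (ctxM s e') xs -> ctx_eq xs (ctxM s (cmul e e')).
  move=> He He'; apply: ctx_eq_sym; apply: ctx_eq_trans (ctx_eq_ctxM _ _ _) _.
  by apply: ctx_eq_trans (ctx_eq_cmul He He') _; apply/rep_eq_ctx_eq/rep_eq_idem.
have Ex := ctx_eq_refl xs.
have [|vs Evs] := @ctx_eq_common xs (map (ctxM s) [:: y; cmul x y; cmul y x]).
  case=> [|[|[|l]]] /=; [exact: ctx_eq_sym | exact: Exx | exact: Exx |].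
  by rewrite nth_nil.
pose Q (g : M) := exists S, [/\ rep_eq (ctxM S x) g, rep_eq (ctxM S y) g,
  rep_eq (ctxM S (cmul x y)) g & rep_eq (ctxM S (cmul y x)) g].
pose S := [seq (true, v) | v <- vs] ++ s.
have [g [Sx Sy Sxy Syx]] : exists g, [/\ rep_eq (ctxM S x) g, rep_eq (ctxM S y) g,
    rep_eq (ctxM S (cmul x y)) g & rep_eq (ctxM S (cmul y x)) g].
  exists (ctxM S x); rewrite /S !ctx_cat.
  by split=> //; apply/esym; [apply: (Evs 0) | apply: (Evs 1) | apply: (Evs 2)].
(* For a projection [g], some context would take the value [a] at both [a] and [b], and [ctx_absorb]
   would make [f] a left zero operation. *)
have ng : ~ is_projection g.
  move/is_projection_binop; pose sA v := [seq (bv.1, rho 1 bv.2 v) | bv <- S].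
  have H a b : ctxA (sA (two a b)) a = binop g rho a b /\
      ctxA (sA (two a b)) b = binop g rho a b.
    have := congr1 (@^~ (two a b)) Sx; have := congr1 (@^~ (two a b)) Sy.
    by rewrite /= !rep_ctx !rep_proj rep_binop => -> ->.
  case=> Hg; apply: not_left_zero => a b.
    by have [] := H a b; rewrite Hg; apply: ctx_absorb.
  by have [Ha Hb] := H b a; rewrite Hg in Ha Hb; apply: ctx_absorb Hb Ha => //; rewrite Hb.
have Qeq p q : rep_eq p q -> Q p -> Q q.
  by move=> Epq [T [E1 E2 E3 E4]]; exists T; rewrite /rep_eq -Epq.
have compf p : ccomp f p = cmul (p ord0) (p ord_max) by rewrite {1}(two_eta p).
have Qcons (b : bool) (w p : M) : Q p -> Q (if b then cmul w p else cmul p w).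
  move=> [T [E1 E2 E3 E4]]; exists ((b, w) :: T).
  by split; case: b => /=; apply: rep_eq_cmul.
(* [I] is a set of variables carrying all the dependence of [h], each of which transmits [Q] to the
   value. *)
have [||I [I1 I2]] := @minimal_generated C hC (fun n (h : C n) => exists I : 'I_n.+1 -> Prop,
    (forall p : 'I_n.+1 -> M, (exists i, I i /\ Q (p i)) -> Q (ccomp h p)) /\
    (forall v v' : 'I_n.+1 -> A, (forall i, I i -> v i = v' i) -> rho n h v = rho n h v'))
    1 f _ _ nf 1 g.
- split=> [n i|n m h k [I [I1 I2]] Hk].
    exists (eq^~ i); split=> [p [_ [-> Qi]]|v v' H]; first by rewrite ccomp_proj.
    by rewrite !rep_proj; apply: H.
  have /choice[J HJ] := Hk.
  exists (fun j => exists i, I i /\ J i j); split.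
    move=> p [j [[i [Ii Jij]] Qj]]; rewrite ccompA; apply: I1; exists i; split=> //.
    by have [+ _] := HJ i; apply; exists j.
  move=> v v' H; rewrite !rep_comp; apply: I2 => i Ii.
  by have [_] := HJ i; apply => j Jij; apply: H; exists i.
- exists (fun=> True); split=> [p [i [_ Qi]]|v v' H]; last first.
    by congr (rho 1 f _); apply/funext => i; apply: H.
  rewrite compf; have [i0|i0] := eqVneq i ord0.
    by rewrite i0 in Qi; apply: (Qcons false).
  suff im : i = ord_max by rewrite im in Qi; apply: (Qcons true).
  by apply: val_inj; case: i i0 {Qi} => -[|[]].
have Iall i : I i.
  apply: contrapT => nI.
  have [j Hj] : exists j : 'I_2, forall k, I k -> k = j.
    exists (if i == ord0 then ord_max else ord0) => k Ik.
    have : k != i by apply/eqP => ki; rewrite ki in Ik.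
    by move=> ki; apply: val_inj; move: ki; case: ifP => [/eqP ->|]; rewrite -!val_eqE /=;
      case: k {Ik} => -[|[]] //; case: i {nI} => -[|[]].
  apply: (nonprojection hC nontriv ng (i := j)) => v.
  rewrite -[RHS](idempotent_rep idem g rho).
  by apply: I2 => k /Hj ->.
pose V (p : M) := [\/ rep_eq p x, rep_eq p y | Q p].
(* [V] holds for [x] and [y] and is closed under [g], hence under [f]; so [x y], being neither [x]
   nor [y], satisfies [Q]. *)
have Veq p q : rep_eq p q -> V p -> V q.
  by move=> Epq [H|H|H]; [apply: Or31 | apply: Or32 | apply: Or33; apply: Qeq H] => //; rewrite /rep_eq -Epq.
have rep_g p v : rho 1 (ccomp g p) v = binop g rho (rho 1 (p ord0) v) (rho 1 (p ord_max) v).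
  by rewrite rep_comp rep_binop.
have [|p Vp|l|H|H|] := @minimal_generated C hC (fun n (h : C n) => forall p : 'I_n.+1 -> M,
    (forall l, V (p l)) -> V (ccomp h p)) 1 g _ _ ng 1 f (two x y) _.
- split=> [n i p Vp|n m h k Hh Hk p Vp]; first by rewrite ccomp_proj.
  by rewrite ccompA; apply: Hh => l; apply: Hk.
- have := Vp ord0; have := Vp ord_max.
  case=> Em; last by move=> _; apply: Or33; apply: I1; exists ord_max.
  + case=> E0; last by apply: Or33; apply: I1; exists ord0.
    * by apply: Or31; apply/funext => v; rewrite rep_g E0 Em idemA.
    (* The value of [g] at [y], [x] is reached by interchanging the generators in [S]; this is why
       [Q] treats [x y] and [y x] alike. *)
    apply: Or33; exists [seq (bv.1, ccomp bv.2 (two y x)) | bv <- S].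
    have sw e v : rho 1 (ctxM [seq (bv.1, ccomp bv.2 (two y x)) | bv <- S] (ccomp e (two y x))) v =
        rho 1 (ctxM S e) (two (rho 1 y v) (rho 1 x v)).
      have ev w : rho 1 (ccomp w (two y x)) v = rho 1 w (two (rho 1 y v) (rho 1 x v)).
        by rewrite rep_comp; congr (rho 1 w _); apply/funext => i; rewrite /two; case: ifP.
      rewrite !rep_ctx ev -map_comp; congr (ctx _ _ _).
      by apply: eq_map => bv /=; rewrite ev.
    have fin e e' : rep_eq (ctxM S e') g -> rep_eq e (ccomp e' (two y x)) ->
        rep_eq (ctxM [seq (bv.1, ccomp bv.2 (two y x)) | bv <- S] e) (ccomp g p).
      move=> E1 /(rep_eq_ctx [seq (bv.1, ccomp bv.2 (two y x)) | bv <- S]) E2.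
      by apply/funext => v; rewrite E2 sw E1 rep_g E0 Em.
    split; [apply: (fin _ y) | apply: (fin _ x) | apply: (fin _ (cmul y x)) | apply: (fin _ (cmul x y))] => //.
    * by rewrite ccomp_proj.
    * by rewrite ccomp_proj.
    * by apply/funext => v; rewrite rep_comp !rep_cmul !rep_proj /two /= ?rep_proj.
    * by apply/funext => v; rewrite rep_comp !rep_cmul !rep_proj /two /= ?rep_proj.
  + case=> E0; last by apply: Or33; apply: I1; exists ord0.
    * apply: Or33; apply: (Qeq g); last by exists S.
      by apply/funext => v; rewrite rep_g E0 Em !rep_proj rep_binop.
    by apply: Or32; apply/funext => v; rewrite rep_g E0 Em idemA.
- by rewrite /two; case: ifP => _; [apply: Or31 | apply: Or32].
- by apply: not_left_zero => a b; have := congr1 (@^~ (two a b)) H; rewrite /= compf rep_cmul !rep_proj.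
- apply: (nonprojection hC nontriv nf (i := ord_max)) => v.
  by have := congr1 (@^~ v) H; rewrite /= compf rep_cmul !rep_proj /= rep_binop.
move=> [T [_ Ty Txy _]]; apply: not_left_zero => a b.
set u := a * b.
have ub : u * b = u.
  have := congr1 (@^~ (two a b)) Txy; have := congr1 (@^~ (two a b)) Ty.
  rewrite /= compf !rep_ctx !rep_cmul !rep_proj /=; exact: (fun H1 H2 => ctx_absorb H2 H1).
apply/esym/cancel.
apply: (corner_conditionP (m := fun i j : bool => (if i then a else u) * (if j then u else b)) cc) => //=.
  apply: corner_binop; first exact: (corner_row _ (fun i : bool => if i then a else u)).
  exact: (corner_col _ (fun j : bool => if j then u else b)).
exact: idemA.
Qed.

(** * Polynomial relations forced by minimality *)

Section Relation.
Local Open Scope ring_scope.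
Variables (G : zmodType) (phi : {additive G -> G}) (iota : M -> G).
Hypothesis iota_x : iota x = 0.
Hypothesis iotaM : forall p q, iota (cmul p q) = iota p - phi (iota p) + phi (iota q).
Local Notation act := (act phi).
Local Notation J := (annihilator phi (iota y)).

(** All elements generated by [g] act through polynomials in [theta]. At 0 and at 1 the coefficients
    of [g] become those of a projection, and composition preserves this. As [g] generates [f], whose
    second coefficient is ['X], the relation follows. *)
Lemma relation (g : M) (theta : {poly int}) : ~ is_projection g ->
  (forall p q, iota (ccomp g (two p q)) = iota p - act theta (iota p) + act theta (iota q)) ->
  exists F, [/\ J ('X - (F \Po theta)), F.[0] = 0 \/ F.[0] = 1 & F.[1] = 0 \/ F.[1] = 1].
Proof.
move=> ng Hg.
pose unit_at n (F : 'I_n.+1 -> {poly int}) c := exists i, forall l, (F l).[c] = (l == i)%:R.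
have compU n m (F : 'I_n.+1 -> {poly int}) (K : 'I_n.+1 -> 'I_m.+1 -> {poly int}) c :
    unit_at n F c -> (forall l, unit_at m (K l) c) ->
    unit_at m (fun k => \sum_l F l * K l k) c.
  move=> [i Fi] HK; have [j Kj] := HK i; exists j => k.
  rewrite horner_sum (bigD1 i) //= big1 ?addr0 => [|l li].
    by rewrite hornerM Fi eqxx mul1r Kj.
  by rewrite hornerM Fi (negPf li) mul0r.
have [||F [FE F0 F1]] := @minimal_generated C hC (fun n (h : C n) =>
    exists F : 'I_n.+1 -> {poly int}, [/\ forall p : 'I_n.+1 -> M,
      iota (ccomp h p) = \sum_l act (F l \Po theta) (iota (p l)),
      unit_at n F 0 & unit_at n F 1]) 1%N g _ _ ng 1%N f.
- split=> [n i|n m h k [F [FE F0 F1]] /choice[K HK]].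
    exists (fun l => (l == i)%:R); split; last 2 first.
    + by exists i => l; rewrite -polyC_natr hornerC.
    + by exists i => l; rewrite -polyC_natr hornerC.
    move=> p; rewrite ccomp_proj (bigD1 i) //= big1 ?addr0 => [|l li].
      by rewrite eqxx -polyC_natr comp_polyC act1.
    by rewrite (negPf li) comp_poly0 act0p.
  exists (fun r => \sum_l F l * K l r); split.
  + move=> p; rewrite ccompA FE.
    have E r : act ((\sum_l F l * K l r) \Po theta) (iota (p r)) =
        \sum_l act (F l \Po theta) (act (K l r \Po theta) (iota (p r))).
      rewrite raddf_sum act_sump; apply: eq_bigr => l _.
      by rewrite /= comp_polyM actM.
    rewrite (eq_bigr _ (fun r _ => E r)) exchange_big; apply: eq_bigr => l _.
    by have [KE _ _] := HK l; rewrite KE act_sum.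
  + by apply: compU => // l; have [] := HK l.
  + by apply: compU => // l; have [] := HK l.
- exists (fun i => if i == ord0 then 1 - 'X else 'X); split.
  + move=> p; rewrite !big_ord_recl big_ord0 addr0 /=.
    rewrite {1}(two_eta p) Hg comp_polyB comp_polyX -polyC1 comp_polyC actBp actC mulr1z.
    by congr (_ + act _ (iota (p _))); apply: val_inj.
  + by exists ord0 => l; case: eqP => _; rewrite !hornerE ?subr0.
  + by exists ord_max => -[[|[]]] // i; rewrite -!val_eqE /= !hornerE ?subrr.
exists (F ord_max); split; last 2 first.
- by case: F0 => i ->; case: eqP => _; [right | left].
- by case: F1 => i ->; case: eqP => _; [right | left].
rewrite /annihilator actBp actX; have := FE (two x y).
rewrite -/(cmul x y) iotaM !big_ord_recl big_ord0 addr0 /= iota_x raddf0 act0 subrr !add0r.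
rewrite (_ : lift ord0 ord0 = ord_max); last exact: val_inj.
by move=> ->; rewrite subrr.
Qed.

Definition lpowM k : M := iter k (cmul x) y.
Definition rpowM k : M := iter k (fun p => cmul p y) x.

Lemma comp_cmul n p q (w : 'I_2 -> C n) : ccomp (cmul p q) w = ccomp f (two (ccomp p w) (ccomp q w)).
Proof. by rewrite /cmul ccompA; apply: comp_ext => i; rewrite /two; case: ifP. Qed.

Lemma iota_lpow k p q : iota (ccomp (lpowM k) (two p q)) =
  iota p - act 'X^k (iota p) + act 'X^k (iota q).
Proof.
elim: k => [|k IH]; first by rewrite expr0 !act1 subrr add0r /= ccomp_proj.
rewrite /= comp_cmul ccomp_proj -/(cmul _ _) iotaM -/(lpowM k) IH.
by rewrite raddfD raddfB /= exprSr !act_mulX !addrA subrK.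
Qed.

Lemma iota_rpow k p q : iota (ccomp (rpowM k) (two p q)) =
  iota p - act (1 - (1 - 'X) ^+ k) (iota p) + act (1 - (1 - 'X) ^+ k) (iota q).
Proof.
have act1X g : act (1 - 'X) g = g - phi g by rewrite actBp act1 actX.
suff -> : iota (ccomp (rpowM k) (two p q)) =
    act ((1 - 'X) ^+ k) (iota p) + iota q - act ((1 - 'X) ^+ k) (iota q).
  by rewrite !actBp !act1 subKr addrA.
elim: k => [|k IH]; first by rewrite expr0 !act1 addrK /= ccomp_proj.
rewrite /= comp_cmul -/(rpowM k) ccomp_proj -/(cmul _ _) iotaM IH.
rewrite exprS !actM !act1X raddfB raddfD /= !opprD !opprK !addrA.
by rewrite [LHS]+%R.[ACl (5*7)*(1*4*2*3*6)] /= addNr add0r.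
Qed.

End Relation.

Lemma rep_lpowM k v : rho 1 (lpowM k) v = lpow f rho k (v ord0) (v ord_max).
Proof. by elim: k => [|k IH] /=; rewrite ?rep_cmul ?IH rep_proj. Qed.

Lemma rep_rpowM k v : rho 1 (rpowM k) v = rpow f rho k (v ord_max) (v ord0).
Proof. by elim: k => [|k IH] /=; rewrite ?rep_cmul ?IH rep_proj. Qed.

Lemma lpow_idem k a : lpow f rho k a a = a.
Proof. by elim: k => //= k ->; apply: idemA. Qed.

Lemma rpow_idem k a : rpow f rho k a a = a.
Proof. by elim: k => //= k ->; apply: idemA. Qed.

(** Take the least power that is a projection. If it were the first projection, the preceding power
    [g] would satisfy [g x (g x y) = x], against [no_xxy]. *)
Lemma lpow_dichotomy : (exists m, forall a b, lpow f rho m.+1 a b = b) \/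
  forall m, ~ is_projection (lpowM m.+1).
Proof.
have [[m0 p0]|H] := pselect (exists m, is_projection (lpowM m.+1)); last first.
  by right=> m pm; apply: H; exists m.
have ex : exists m, `[< is_projection (lpowM m.+1) >] by exists m0; apply/asboolP.
left; case: (ex_minnP ex) => m /asboolP/is_projection_binop pm mmin.
have E k a b : binop (lpowM k) rho a b = lpow f rho k a b by rewrite /binop rep_lpowM.
exists m => a b; rewrite -E; case: pm => pm; last exact: pm.
case: m => [|m] in pm mmin *.
  by case: not_left_zero => c d; rewrite -[RHS](pm c d) E.
have np : ~ is_projection (lpowM m.+1).
  by move/asboolP/mmin; rewrite ltnn.
case: (no_xxy np) => c d; rewrite !E /lpow -iterD addSnnS iterD.
by rewrite -[iter m.+2 _ _]/(lpow f rho m.+2 c d) -E pm; apply: lpow_idem.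
Qed.

Lemma rpow_dichotomy : (exists m, forall a b, rpow f rho m.+1 b a = a) \/
  forall m, ~ is_projection (rpowM m.+1).
Proof.
have [[m pm]|H] := pselect (exists m, is_projection (rpowM m.+1)); last first.
  by right=> m pm; apply: H; exists m.
left; exists m => a b.
have [H|H] := is_projection_binop pm.
  by rewrite -[RHS](H a b) /binop rep_rpowM.
have all_eq (c d : A) : c = d.
  have: rpow f rho m.+1 d c = d by rewrite -[RHS](H c d) /binop rep_rpowM.
  by elim: (m.+1) => //= k IH /cancel.
exact: all_eq.
Qed.

Lemma cancellative_weakly_abelian (B : Type) (sigma : representation C B) :
  weakly_abelian (rep_algebra sigma).
Proof.
have [G [phi [iota [[iota_x iota_eq] iotaM inj0 inj1 ker]]]] := affine_quotient.
pose J := annihilator phi (iota y).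
have idJ : poly_ideal J := annihilator_ideal phi (iota y).
(* Otherwise [iota y = 0], and some context would identify [x] and [y]. *)
have J1 : ~ J 1%R.
  by rewrite /J /annihilator act1 => /ker[s]; apply: ctx_separates.
have rel := relation iota_x iotaM.
have satX P : J ('X * P)%R -> J P by rewrite /J /annihilator actM actX => /inj0.
have sat1X P : J ((1 - 'X) * P)%R -> J P.
  rewrite /J /annihilator actM actBp act1 actX => E; apply: inj1.
  by apply/esym/eqP; rewrite -subr_eq0 E.
have relL k : ~ is_projection (lpowM k) -> exists F : {poly int},
    [/\ J ('X - (F \Po 'X^k))%R, F.[0]%R = 0%R \/ F.[0]%R = 1%R & F.[1]%R = 0%R \/ F.[1]%R = 1%R].
  by move=> nk; apply: (rel _ _ nk) => p q; apply: (iota_lpow iotaM).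
have relR k : ~ is_projection (rpowM k) -> exists F : {poly int},
    [/\ J ((1 - 'X) - (F \Po (1 - 'X) ^+ k))%R, F.[0]%R = 0%R \/ F.[0]%R = 1%R & F.[1]%R = 0%R \/ F.[1]%R = 1%R].
  move=> nk; have [|F [JF F0 F1]] := rel _ (1 - (1 - 'X) ^+ k)%R nk.
    by move=> p q; apply: (iota_rpow iotaM).
  exists (1 - (F \Po (1 - 'X)))%R; split.
  - have [_ _ IM] := idJ; have := IM _ (-1)%R JF; congr J.
    rewrite comp_polyB -polyC1 comp_polyC -comp_polyA comp_polyB comp_polyC comp_polyX polyC1.
    ring.
  - by rewrite !hornerE horner_comp !hornerE; case: F1 => ->; [right | left]; rewrite ?subr0 ?subrr.
  - by rewrite !hornerE horner_comp !hornerE subrr; case: F0 => ->; [right | left]; rewrite ?subr0 ?subrr.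
(* Either a power of ['X] acts on [iota y] as 1, or the relation for exponent 2 yields the
   inverse. *)
have unitX : exists U, J (1 - 'X * U)%R.
  have [[m mE]|np] := lpow_dichotomy; last first.
    by have [F [JF F0 _]] := relL 2 (np 1%N); apply: unit_of_square idJ satX JF F0.
  exists ('X^m)%R; rewrite -exprS /J /annihilator actBp act1.
  have := iota_lpow iotaM m.+1 x y; rewrite iota_x act0 subrr add0r => <-.
  apply/eqP; rewrite subr_eq0; apply/eqP/iota_eq/funext => v.
  by rewrite rep_comp rep_lpowM mE.
have unit1X : exists V, J (1 - (1 - 'X) * V)%R.
  have [[m mE]|np] := rpow_dichotomy; last first.
    by have [F [JF F0 _]] := relR 2 (np 1%N); apply: unit_of_square idJ sat1X JF F0.
  exists ((1 - 'X) ^+ m)%R; rewrite -exprS /J /annihilator.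
  have := iota_rpow iotaM m.+1 x y; rewrite iota_x act0 subrr add0r => <-.
  rewrite -[RHS]iota_x; apply/iota_eq/funext => v.
  by rewrite rep_comp rep_rpowM mE.
have [[m mE]|np] := lpow_dichotomy; last first.
  case: J1; apply: no_exceptional_unit => // -[|k] // _.
  by have [F [JF _ F1]] := relL k.+1 (np k); exists F.
have [[m' mE']|np] := rpow_dichotomy; last first.
  (* The substitution of [1 - 'X] is an involution exchanging left and right powers. *)
  have comp1X P : ((P \Po (1 - 'X)) \Po (1 - 'X) = P :> {poly int})%R.
    rewrite -comp_polyA comp_polyB -polyC1 comp_polyC comp_polyX polyC1.
    by rewrite subKr comp_polyXr.
  case: J1; have := @no_exceptional_unit (fun P => J (P \Po (1 - 'X))%R).
  rewrite -[X in J (X \Po _)%R]polyC1 comp_polyC polyC1; apply.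
  - exact: comp_ideal.
  - have [V JV] := unit1X; exists (V \Po (1 - 'X))%R.
    by rewrite comp_polyB comp_polyM comp1X comp_polyX -polyC1 comp_polyC polyC1.
  - have [U JU] := unitX; exists (U \Po (1 - 'X))%R.
    by rewrite comp_polyB comp_polyM comp1X comp_polyB comp_polyX -polyC1 comp_polyC polyC1 subKr.
  case=> // k _; have [F [JF _ F1]] := relR k.+1 (np k); exists F; split=> //.
  rewrite comp_polyB comp_polyX -comp_polyA comp_Xn_poly; exact: JF.
(* The Maltsev term [(x / y) (y \ z)]: the powers [m'] and [m] are the inverses of the right and
   left multiplications by [y]. *)
pose F (D : Type) (tau : representation C D) (v : 'I_3 -> D) :=
  binop f tau (rpow f tau m' (v (inord 1)) (v ord0)) (lpow f tau m (v (inord 1)) (v ord_max)).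
have [p pE] : uniform F.
  apply: uniform_binop; first by apply: uniform_rpow; apply: uniform_var.
  by apply: uniform_lpow; apply: uniform_var.
apply: (maltsev_weakly_abelian hC (p := p) nontriv (corner_weakly_abelian cc)) => a b;
  rewrite pE /F three1 /=.
- by rewrite lpow_idem; apply: mE'.
- by rewrite rpow_idem; apply: mE.
Qed.

End Cancellative.

(** * The case distinction *)

Theorem theorem5p3 (C : clone) (hC : minimal_clone C) :
  (exists (A : Type) (rho : representation C A),
      ~ trivial_algebra (rep_algebra rho) /\
      weakly_abelian (rep_algebra rho)) ->
  forall (B : Type) (sigma : representation C B),
    weakly_abelian (rep_algebra sigma).
Proof.
move=> [A [rho [nt wab]]] B sigma.
have cc := weakly_abelian_corner wab.
have [idem|/existsNP[g ng]] := pselect (forall h : C 0, is_projection h); last first.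
  exact: (unary_generated hC ng).
have [triv|/existsNP[f nf]] := pselect (forall h : C 1, is_projection h).
  exact: (no_binary_weakly_abelian hC nt wab triv).
have cancellative (g : C 1) : ~ is_projection g ->
    (forall z u, binop g rho z u = u -> z = u) -> weakly_abelian (rep_algebra sigma).
  move=> ng cancel.
  have [[h [nh xxy]]|no_xxy] := pselect (exists h : C 1, ~ is_projection h /\
      forall x y, binop h rho x (binop h rho x y) = x).
    exact: (pcyclic_weakly_abelian idem hC nt cc nh xxy).
  apply: (cancellative_weakly_abelian idem hC nt cc ng cancel) => h nh xxy.
  by apply: no_xxy; exists h.
(* If [f] fails to be cancellative on either side it yields rectangular bands; otherwise [f] or its
   opposite satisfies the hypothesis of [cancellative]. *)
have [[q [w [wq wn]]]|noq] := pselect (exists q w, binop f rho w q = q /\ w <> q); last first.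
  apply: (cancellative f nf) => z u zu; apply: contrapT => zn.
  by apply: noq; exists u, z.
have [[p [z [pz zn]]]|nop] := pselect (exists p z, binop f rho p z = p /\ z <> p).
  exact: (rectangular_weakly_abelian idem hC cc nf pz zn wq wn).
apply: (cancellative (opposite f)) => [pf|z u].
  have [H|H] := is_projection_binop rho pf.
    apply: (nonprojection hC nt nf (i := ord_max)) => v.
    by rewrite rep_binop -binop_opposite H.
  apply: (nonprojection hC nt nf (i := ord0)) => v.
  by rewrite rep_binop -binop_opposite H.
rewrite binop_opposite => uz; apply: contrapT => zn.
by apply: nop; exists u, z.
Qed.
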